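(* Let $f$ be an $m$ times renormalizable ($0\le m\le\infty$) expanding Lorenz map on $I=[a,b]$, let $[a_i,b_i]$ ($0\le i\le m$) be the renormalization interval of the $i$th renormalization $R^if$ (with $[a_0,b_0]=[a,b]$), and let $orb([a_i,b_i])=\bigcup_{n\ge0}f^n([a_i,b_i])$. Then: (1) $f$ admits $m$ proper $\alpha$-limit sets, which can be ordered as $$\emptyset=E_0\subset E_1\subset E_2\subset\cdots\subset E_m\subset I.$$ (2) For $0<i\le m$, $E_i$ is a Cantor set if the $i$th renormalization is not periodic, and $E_i'=E_{i-1}$ if the $i$th renormalization is periodic. (3) For $0<i\le m$, $\alpha(x)=E_i$ if and only if $$x\in orb([a_{i-1},b_{i-1}])\setminus orb([a_i,b_i]),$$ and $\alpha(x)=I$ if and only if $$x\in A:=\bigcap_{i=0}^m orb([a_i,b_i]).$$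
   Context: A Lorenz map on $I=[a,b]$ is a map $f:I\to I$ for which there is $c\in(a,b)$ (the discontinuity) such that: (i) $f$ is continuous and strictly increasing on $[a,c)$ and on $(c,b]$; (ii) $\lim_{x\uparrow c}f(x)=b$ and $\lim_{x\downarrow c}f(x)=a$. It is expanding if in addition (iii) the set $\bigcup_{n\ge0}f^{-n}(c)$ is dense in $I$. The value $f(c)$ is left undefined; $c$ is regarded as two points $c+$ and $c-$, with $f(c+)=a$ and $f(c-)=b$; $f^k(c+)$ and $f^k(c-)$ are the one-sided limits of $f^k$ at $c$ from the right and from the left. The $\alpha$-limit set of $x\in I$ is $\alpha(x)=\bigcap_{n\ge0}\overline{\bigcup_{k\ge n}f^{-k}(x)}$. A subset of $I$ is proper if it is different from $I$. $A'$ denotes the derived set (set of accumulation points) of $A$. A Lorenz map $f$ is renormalizable if there are a proper subinterval $[u,v]\ni c$ of $I$ and integers $\ell,r>1$ such that the map $g:[u,v]\to[u,v]$ given by $g(x)=f^{\ell}(x)$ for $x\in[u,c)$ and $g(x)=f^{r}(x)$ for $x\in(c,v]$ is itself a Lorenz map on $[u,v]$ (with discontinuity $c$); such $g=(f^\ell,f^r)$ is called a renormalization of $f$ and $[u,v]$ its renormalization interval. A renormalization $(f^\ell,f^r)$ is minimal if for any other renormalization $(f^{\ell'},f^{r'})$ of $f$ one has $\ell'\ge\ell$ and $r'\ge r$. The minimal renormalization of a renormalizable expanding Lorenz map exists, is denoted $Rf$, and is again an expanding Lorenz map. Put $R^0f=f$ and $R^nf=R(R^{n-1}f)$ if $R^{n-1}f$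 is renormalizable. $f$ is $m$ times renormalizable ($0\le m\le\infty$) if this process can proceed exactly $m$ times; $R^if$ is called the $i$th renormalization of $f$. When $m=\infty$, the index $i$ ranges over all finite integers. A set $E\subseteq I$ is completely invariant under $f$ if $f(E)=E=f^{-1}(E)$. For a nonempty open interval $U\subseteq I$, $N(U)=\min\{n\ge0:\exists z\in U \text{ with } f^n(z)=c\}$. For a proper nonempty completely invariant closed set $E$ put $e_-=\sup\{x\in E:x<c\}$, $e_+=\inf\{x\in E:x>c\}$, $\ell=N((e_-,c))$, $r=N((c,e_+))$; the renormalization $R_Ef$ associated with $E$ equals $f^\ell$ on $[f^r(c+),c)$ and $f^r$ on $(c,f^\ell(c-)]$. Every renormalization $g$ of $f$ equals $R_Ef$ for a unique such $E$; the critical interval of $g$ is then $(e_-,e_+)$. A renormalization is periodic if the two endpoints of its critical interval belong to the same periodic orbit.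
   Formalization: It is assumed that each R^i f (0<i≤m) equals R_E f for some proper nonempty completely invariant closed set E, which defines its critical interval; without this the claim fails, e.g. for f(x)=√2x+1−√2/2 mod 1, where m=1 but orb([a_1,b_1])=I. *)

(* Defs.v *)
From mathcomp Require Export all_boot all_order all_algebra.
From mathcomp Require Export all_classical all_reals all_analysis.

Set Implicit Arguments.
Unset Strict Implicit.
Unset Printing Implicit Defensive.

Import Order.TTheory GRing.Theory Num.Theory.
Import numFieldNormedType.Exports.

Local Open Scope classical_set_scope.
Local Open Scope ring_scope.

(* A map on [lo, hi] with a distinguished point [disc].  The values of the
   underlying function at [disc] and outside [lo, hi] are irrelevant: no
   definition below depends on them. *)
Record pmap (R : realType) := PMap {
  pfun :> R -> R;
  lo : R;
  hi : R;
  disc : R }.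

Section Lorenz.
Context {R : realType}.
Implicit Types (F G : pmap R) (A E U : set R) (x y : R) (n l r : nat).

Definition dom F : set R := `[lo F, hi F]%classic.

Definition is_lorenz F : Prop :=
  [/\ lo F < disc F < hi F,
      forall x, dom F x -> x != disc F -> dom F (F x),
      {within `[lo F, disc F[%classic, continuous F} /\
        {in `[lo F, disc F[ &, {homo F : x y / x < y}},
      {within `]disc F, hi F]%classic, continuous F} /\
        {in `]disc F, hi F] &, {homo F : x y / x < y}}
    & F x @[x --> (disc F)^'-] --> hi F /\ F x @[x --> (disc F)^'+] --> lo F].

(* One step of the dynamics: the discontinuity c stands for the two points
   c- and c+, sent to [hi] and [lo] respectively.  Hence c is a preimage of both
   endpoints, and both endpoints belong to the image of any set containing c. *)
Definition step F x y : Prop :=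
  dom F x /\ ((x != disc F /\ y = F x) \/ (x = disc F /\ (y = lo F \/ y = hi F))).

Definition img F A : set R := [set y | exists2 x, A x & step F x y].
Definition preimg F A : set R := [set x | exists2 y, A y & step F x y].

(* [backward F n x] is f^{-n}(x). *)
Definition backward F n x : set R := iter n (preimg F) [set x].

Definition expanding F : Prop :=
  dom F `<=` closure (\bigcup_n backward F n (disc F)).

Definition alpha F x : set R :=
  \bigcap_n closure (\bigcup_(k in [set k | (n <= k)%N]) backward F k x).

Definition orb F A : set R := \bigcup_n iter n (img F) A.

(* Since the value at c is undefined, f^n(x) makes sense as a value only when
   the orbit of x does not meet c before time n. *)
Definition iter_def F n x : Prop := forall j, (j < n)%N -> iter j F x != disc F.

Definition renorm F l r G : Prop :=
  [/\ (1 < l)%N /\ (1 < r)%N,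
      dom G `<` dom F /\ disc G = disc F,
      forall x, lo G <= x < disc F -> iter_def F l x /\ G x = iter l F x,
      forall x, disc F < x <= hi G -> iter_def F r x /\ G x = iter r F x
    & is_lorenz G].

Definition renormalizable F : Prop := exists l r G, renorm F l r G.

(* G is Rf. *)
Definition min_renorm F G : Prop :=
  exists l r, renorm F l r G /\
    forall l' r' G', renorm F l' r' G' -> (l <= l')%N /\ (r <= r')%N.

(* [None] stands for infinity; the index i ranges over finite integers. *)
Definition le_ext (i : nat) (m : option nat) : Prop :=
  if m is Some k then (i <= k)%N : Prop else True.

(* f is exactly m times renormalizable, and G i is R^i f for i <= m. *)
Definition renorm_tower F (m : option nat) (G : nat -> pmap R) : Prop :=
  [/\ G 0%N = F,
      forall i, le_ext i.+1 m -> min_renorm (G i) (G i.+1)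
    & forall k, m = Some k -> ~ renormalizable (G k)].

Definition completely_invariant F E : Prop :=
  [/\ E `<=` dom F, img F E = E & preimg F E = E].

(* [hit_time F U n] is n = N(U). *)
Definition hit_time F U n : Prop :=
  U `&` backward F n (disc F) !=set0 /\
  forall k, (k < n)%N -> U `&` backward F k (disc F) = set0.

Definition e_minus F E : R := sup [set x | E x /\ x < disc F].
Definition e_plus F E : R := inf [set x | E x /\ disc F < x].

(* G is R_E f. *)
Definition renorm_of F E G : Prop :=
  exists l r,
    [/\ hit_time F `]e_minus F E, disc F[%classic l /\
        hit_time F `]disc F, e_plus F E[%classic r,
        disc G = disc F,
        iter r F x @[x --> (disc F)^'+] --> lo G /\
        iter l F x @[x --> (disc F)^'-] --> hi G,
        forall x, lo G <= x < disc F -> iter_def F l x /\ G x = iter l F x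
      & forall x, disc F < x <= hi G -> iter_def F r x /\ G x = iter r F x].

(* E is the completely invariant set of the renormalization G of f, so that the
   critical interval of G is ]e_minus F E, e_plus F E[.  No such E exists when
   G fixes an endpoint of its interval: that endpoint, f^r(c+) or f^l(c-), is
   an endpoint of the critical gap, which puts c in f^{-n}(E). *)
Definition associated F E G : Prop :=
  [/\ E !=set0, closed E, E `<` dom F, completely_invariant F E
    & renorm_of F E G].

Definition same_periodic_orbit F x y : Prop :=
  (exists p, [/\ (0 < p)%N, iter_def F p x & iter p F x = x]) /\
  (exists k, iter_def F k x /\ iter k F x = y).

(* Periodicity of the renormalization of f associated with E. *)
Definition periodic F E : Prop :=
  same_periodic_orbit F (e_minus F E) (e_plus F E).

Definition cantor_set A : Prop :=
  [/\ A !=set0, compact A, perfect_set A & totally_disconnected A].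

End Lorenz.

(* Main.v *)
(* Let E be completely invariant, closed, proper and nonempty, with gap ]p, q[
   around c.  The first passage of ]p, c[ over c is f^l, which fixes p and pushes
   the points of ]p, c[ to the right, since an interval that never meets c would
   contradict the expanding property; the same holds on ]c, q[.  Hence every point
   outside E enters the renormalization interval of R_E f, and E is determined by
   its gap.  If x is not in the orbit of the interval of R^i f, then alpha(x) is
   contained in E_i; if x is in the orbit of the interval of R^(i-1) f, then
   alpha(x) meets this interval, on which it defines a renormalization of R^(i-1) f,
   and the minimality of R^i f forces the gaps of alpha(x) and E_i to coincide.
   If x is in the orbits of all the intervals, then c is in alpha(x): otherwise
   alpha(x) would define a further renormalization (m finite), or would miss a
   neighbourhood of c while meeting intervals that shrink to c (m infinite).
   Finally, an isolated point of E_i is an endpoint of two gaps, so that its orbit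
   passes through both p and q. *)

Require Import Defs.
From mathcomp Require Import lra.
Import Order.TTheory GRing.Theory Num.Theory.
Import numFieldNormedType.Exports.
Local Open Scope classical_set_scope.
Local Open Scope ring_scope.

Set Implicit Arguments.
Unset Strict Implicit.
Unset Printing Implicit Defensive.

(** * Orbits up to the first passage over c *)

Section IterDef.
Context {R : realType}.
Implicit Types (F G : pmap R) (A E U : set R) (x y z : R) (n k l r : nat).

(** Two difficulties shape the proof. An alpha-limit set is backward invariant only away from the
    endpoints of the domain, so the analysis of gaps runs under the weak notion [qinv]; the sets E_i
    avoid both endpoints, satisfy the stronger [cinv], and only for them does every outside point
    enter the gap. Moreover, minimality of R^i f counts iterates of R^(i-1) f, whereas the gap of
    E_i and its return times are counted in iterates of f. The two counts are compared through
    expansion: if two powers of f agree on an interval whose points have not yet met c, the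
    exponents are equal, since otherwise the interval would never meet c. *)

Lemma domP F x : dom F x <-> lo F <= x <= hi F.
Proof. by rewrite /dom /= in_itv /=. Qed.

Lemma iter_defS F n x :
  iter_def F n.+1 x <-> x != disc F /\ iter_def F n (F x).
Proof.
split=> [h|[h1 h2] [|j] //= jn].
  split; first exact: (h 0%N).
  by move=> j jn; rewrite -iterSr; apply: h.
by rewrite -[F (iter j F x)]/(iter j.+1 F x) iterSr; apply: h2.
Qed.

Lemma iter_def_le F k n x : (k <= n)%N -> iter_def F n x -> iter_def F k x.
Proof. by move=> kn h j jk; apply: h; apply: leq_trans kn. Qed.

Lemma iter_defD F k n x :
  iter_def F (k + n) x <-> iter_def F k x /\ iter_def F n (iter k F x).
Proof.
split=> [h|[h1 h2] j].
  split; first by apply: iter_def_le h; rewrite leq_addr.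
  by move=> j jn; rewrite -iterD addnC; apply: h; rewrite ltn_add2l.
case: (ltnP j k) => [jk _|kj jkn]; first exact: h1.
by rewrite -(subnK kj) iterD; apply: h2; rewrite ltn_subLR.
Qed.

Lemma iter_def_hit F n x : iter_def F n x -> iter n F x = disc F ->
  forall k, iter_def F k x -> (k <= n)%N.
Proof. by move=> h e k hk; rewrite leqNgt; apply/negP => /hk; rewrite e eqxx. Qed.

(** [iter] may run through [disc F], where the value of [F] is arbitrary; cutting the orbit at its
    first visit to c makes it meaningful. *)
Lemma first_hit F n x : iter n F x = disc F ->
  exists k, [/\ (k <= n)%N, iter_def F k x & iter k F x = disc F].
Proof.
elim: n x => [|n IH] x; first by move=> h; exists 0%N.
rewrite iterSr => /IH[k [kn h1 h2]].
have [xc|xc] := eqVneq x (disc F); first by exists 0%N.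
exists k.+1; split => //; first by apply/iter_defS.
by rewrite iterSr.
Qed.

Lemma backwardS F n x y :
  backward F n.+1 x y <-> exists2 z, backward F n x z & step F y z.
Proof. by []. Qed.

Lemma backwardD F k n x y z :
  backward F n x y -> backward F k y z -> backward F (k + n) x z.
Proof.
move=> h; elim: k z => [|k IH] z /=; first by move=> ->.
by case=> w /IH hw s; exists w.
Qed.

Lemma step_det F x y : step F x y -> x != disc F -> y = F x.
Proof. by case=> _ [[_ ->]//|[-> _]]; rewrite eqxx. Qed.

Lemma backward_iter_def F n k x y :
  backward F (k + n) x y -> iter_def F k y -> backward F n x (iter k F y).
Proof.
elim: k y => [//|k IH] y; rewrite addSn => /backwardS [z hz s] /iter_defS[yc hk].
by rewrite iterSr; apply: IH => //; rewrite -(step_det s yc).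
Qed.

Lemma backward_dom F n x y : dom F x -> backward F n x y -> dom F y.
Proof. by move=> dx; case: n => [->//|n] /backwardS [z _ []]. Qed.

Lemma backward_hit F n x : backward F n (disc F) x ->
  exists k, [/\ (k <= n)%N, iter_def F k x & iter k F x = disc F].
Proof.
elim: n x => [|n IH] x; first by move=> ->; exists 0%N.
move=> /backwardS[z /IH[k [kn h1 h2]] s].
have [xc|xc] := eqVneq x (disc F); first by exists 0%N.
move: (step_det s xc) h1 h2 => -> h1 h2.
exists k.+1; split => //; first by apply/iter_defS.
by rewrite iterSr.
Qed.

(** Restates forward images through preimages, the language in which alpha-limit sets are
    defined. *)
Lemma orbP F A x : orb F A x <-> exists n, exists2 y, A y & backward F n x y.
Proof.
have H n : forall A, iter n (img F) A x <-> exists2 y, A y & backward F n x y.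
  elim: n => [|n IH] B.
    by split => [Bx|[y By <-]//]; exists x.
  rewrite iterSr IH; split => [[y [z Bz s] hy]|[z Bz /backwardS[y hy s]]].
    by exists z => //; apply/backwardS; exists y.
  by exists y => //; exists z.
by split=> [[n _ /H]|[n /H]]; exists n.
Qed.

End IterDef.

Lemma near_neq {R : realType} (x a : R) : x != a -> \forall y \near x, y != a.
Proof.
rewrite neq_lt => /orP[/lt_nbhsl|/lt_nbhsr].
  by apply: filterS => y /lt_eqF ->.
by apply: filterS => y /gt_eqF ->.
Qed.

Lemma cvg_withinP {R : realType} (f : R -> R) (A : set R) (x l : R) :
  f y @[y --> within A (nbhs x)] --> l <->
  forall U, nbhs l U -> \forall y \near x, A y -> U (f y).
Proof. by split=> h U /h. Qed.

(** * The two branches of a Lorenz map and intervals that avoid c *)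

Section Lorenz.
Context {R : realType}.
Context (F : pmap R).
Context (hF : is_lorenz F).
Implicit Types (A E U : set R) (x y z : R) (n k l r : nat).
Local Notation c := (disc F).

Lemma lorenz_lt : lo F < c < hi F.
Proof. by case: hF. Qed.

Lemma lorenz_lo : lo F < c.
Proof. by case/andP: lorenz_lt. Qed.

Lemma lorenz_hi : c < hi F.
Proof. by case/andP: lorenz_lt. Qed.

Lemma disc_dom : dom F c.
Proof. by apply/domP; rewrite (ltW lorenz_lo) (ltW lorenz_hi). Qed.

Lemma lorenz_dom x : dom F x -> x != c -> dom F (F x).
Proof. by case: hF => _ h _ _ _; apply: h. Qed.

Lemma incL x y : lo F <= x -> x < y -> y < c -> F x < F y.
Proof.
case: hF => _ _ [_ h] _ _ ax xy yc; apply: h => //; rewrite in_itv /=.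
  by rewrite ax (lt_trans xy).
by rewrite yc (le_trans ax (ltW xy)).
Qed.

Lemma incR x y : c < x -> x < y -> y <= hi F -> F x < F y.
Proof.
case: hF => _ _ _ [_ h] _ cx xy yb; apply: h => //; rewrite in_itv /=.
  by rewrite cx (le_trans (ltW xy)).
by rewrite yb (lt_trans cx).
Qed.

Lemma cvg_lorenz x : dom F x -> x != c -> F y @[y --> within (dom F) (nbhs x)] --> F x.
Proof.
case: hF => _ _ [cL _] [cR _] _ /domP/andP[ax xb]; rewrite neq_lt => /orP[xc|cx].
  have /subspace_continuousP/(_ x) := cL.
  rewrite /= in_itv /= ax xc => /(_ isT)/cvg_withinP h.
  apply/cvg_withinP => U /h hU; have := lt_nbhsl xc.
  apply: filterS2 hU => y hU yc /domP/andP[ay yb].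
  by apply: hU; rewrite /= in_itv /= ay yc.
have /subspace_continuousP/(_ x) := cR.
rewrite /= in_itv /= cx xb => /(_ isT)/cvg_withinP h.
apply/cvg_withinP => U /h hU; have := lt_nbhsr cx.
apply: filterS2 hU => y hU yc /domP/andP[ay yb].
by apply: hU; rewrite /= in_itv /= yb yc.
Qed.

Lemma iter_dom n x : dom F x -> iter_def F n x -> dom F (iter n F x).
Proof.
elim: n x => [//|n IH] x dx /iter_defS[xc h].
by rewrite iterSr; apply: IH => //; apply: lorenz_dom.
Qed.

Lemma backward_iter n x y : dom F y -> iter_def F n y -> iter n F y = x ->
  backward F n x y.
Proof.
elim: n y => [//|n IH] y dy /iter_defS[yc h]; rewrite iterSr => e.
apply/backwardS; exists (F y); last by split => //; left.
by apply: IH => //; apply: lorenz_dom.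
Qed.

Lemma ivt x y t : lo F <= x -> x <= y -> y <= hi F -> (y < c) || (c < x) ->
  F x <= t <= F y -> exists2 z, x <= z <= y & F z = t.
Proof.
move=> ax xy yb cxy t1.
have ms z : z \in `[x, y] -> dom F z /\ z != c.
  rewrite in_itv /= => /andP[xz zy]; split.
    by apply/domP; rewrite (le_trans ax xz) (le_trans zy yb).
  case/orP: cxy => h; first by rewrite lt_eqF // (le_lt_trans zy).
  by rewrite gt_eqF // (lt_le_trans h).
have [z zi <-] : exists2 z, z \in `[x, y] & F z = t.
  apply: IVT => //.
    apply/subspace_continuousP => z /ms[dz zc].
    have /cvg_withinP h := cvg_lorenz dz zc.
    by apply/cvg_withinP => U /h; apply: filterS => w hU /ms[/hU].
  have h : F x <= F y by case/andP: t1 => u v; exact: le_trans v.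
  by rewrite (min_l h) (max_r h).
by exists z => //; rewrite in_itv in zi.
Qed.

Lemma ltL x : lo F <= x -> x < c -> F x < hi F.
Proof.
move=> ax xc; have [xm mc] := midf_lt xc.
apply: lt_le_trans (incL ax xm mc) _.
have am : lo F <= ((x + c) / 2%:R) by apply: le_trans (ltW xm).
have /domP/andP[//] : dom F (F ((x + c) / 2%:R)).
apply: lorenz_dom; last by rewrite lt_eqF.
by apply/domP; rewrite am (ltW (lt_trans mc lorenz_hi)).
Qed.

Lemma gtR x : c < x -> x <= hi F -> lo F < F x.
Proof.
move=> cx xb; have [cm mx] := midf_lt cx.
apply: le_lt_trans (incR cm mx xb).
have mb : ((c + x) / 2%:R) <= hi F by apply: le_trans xb; apply: ltW.
have /domP/andP[//] : dom F (F ((c + x) / 2%:R)).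
apply: lorenz_dom; last by rewrite gt_eqF.
by apply/domP; rewrite mb (ltW (lt_trans lorenz_lo cm)).
Qed.

Lemma cvgL : F x @[x --> c^'-] --> hi F.
Proof. by case: hF => _ _ _ _ []. Qed.

Lemma cvgR : F x @[x --> c^'+] --> lo F.
Proof. by case: hF => _ _ _ _ []. Qed.

Lemma surjL x t : lo F <= x -> x < c -> F x <= t -> t < hi F ->
  exists2 z, x <= z < c & F z = t.
Proof.
move=> ax xc xt tb.
have [y [xy yc ty]] : exists y, [/\ x < y, y < c & t < F y].
  apply: (@filter_ex _ c^'-); near=> y; split; near: y.
  - exact: nbhs_left_gt.
  - exact: nbhs_left_lt.
  - exact: (cvgr_gt _ cvgL).
have yb : y <= hi F by apply: ltW (lt_trans yc lorenz_hi).
have [||z /andP[xz zy] <-] := ivt ax (ltW xy) yb _ (t := t).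
- by rewrite yc.
- by rewrite xt ltW.
by exists z => //; rewrite xz (le_lt_trans zy).
Unshelve. all: by end_near. Qed.

(** The induction step for iterates on intervals: an interval that avoids c lies in one branch, so
    its image is again an interval, with one step less to control. *)
Lemma nohit_img n x y : lo F <= x -> x <= y -> y <= hi F ->
  (forall z, x <= z <= y -> iter_def F n.+1 z) ->
  [/\ (y < c) || (c < x), lo F <= F x, F x <= F y, F y <= hi F &
   forall z, F x <= z <= F y -> exists2 w, x <= w <= y & F w = z].
Proof.
move=> ax xy yb h.
have cxy : (y < c) || (c < x).
  case: (ltP y c) => //= cy; rewrite ltNge; apply/negP => xc.
  have /iter_defS[] : iter_def F n.+1 c by apply: h; rewrite xc.
  by rewrite eqxx.
have dx : dom F x by apply/domP; rewrite ax (le_trans xy).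
have dy : dom F y by apply/domP; rewrite yb (le_trans ax).
have xc : x != c.
  by case/orP: cxy => [u|u]; [rewrite lt_eqF // (le_lt_trans xy)|rewrite gt_eqF].
have yc : y != c.
  by case/orP: cxy => [u|u]; [rewrite lt_eqF|rewrite gt_eqF // (lt_le_trans u)].
have /domP/andP[h1 _] := lorenz_dom dx xc.
have /domP/andP[_ h2] := lorenz_dom dy yc.
split => //.
  move: xy; rewrite le_eqVlt => /orP[/eqP->//|xy]; apply: ltW.
  by case/orP: cxy => u; [apply: incL|apply: incR].
by move=> z hz; apply: ivt.
Qed.

Lemma iter_mono n x y : lo F <= x -> x < y -> y <= hi F ->
  (forall z, x <= z <= y -> iter_def F n z) -> iter n F x < iter n F y.
Proof.
elim: n x y => [//|n IH] x y ax xy yb h; rewrite !iterSr.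
have [cxy h1 h2 h3 h4] := nohit_img ax (ltW xy) yb h.
apply: IH => //.
  by case/orP: cxy => u; [apply: incL|apply: incR].
by move=> z /h4[w /h/iter_defS[_ hw] <-].
Qed.

Lemma iter_ivt n x y t : lo F <= x -> x <= y -> y <= hi F ->
  (forall z, x <= z <= y -> iter_def F n z) ->
  iter n F x <= t <= iter n F y -> exists2 z, x <= z <= y & iter n F z = t.
Proof.
elim: n x y => [|n IH] x y ax xy yb h; first by exists t.
rewrite !iterSr => ht.
have [cxy h1 h2 h3 h4] := nohit_img ax xy yb h.
have [] := IH _ _ h1 h2 h3 _ ht.
  by move=> z /h4[w /h/iter_defS[_ hw] <-].
move=> z /h4[w hw <-] <-; exists w => //; by rewrite iterSr.
Qed.

(* Points that come before the first hit of c are squeezed between the orbits of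
   their neighbours, hence stay away from both endpoints. *)
Lemma iter_inside n k x y z : (k <= n)%N -> lo F <= x -> x < z -> z < y ->
  y <= hi F -> (forall w, x < w < y -> iter_def F n w) ->
  lo F < iter k F z < hi F.
Proof.
move=> kn ax xz zy yb h.
have [xx1 x1z] := midf_lt xz; have [zy1 y1y] := midf_lt zy.
set x1 := (x + z) / _ in xx1 x1z; set y1 := (z + y) / _ in zy1 y1y.
have ax1 : lo F <= x1 by rewrite (le_trans ax (ltW _)).
have y1b : y1 <= hi F by rewrite (le_trans (ltW y1y)).
have h' w : x1 <= w <= y1 -> iter_def F k w.
  move=> /andP[u v]; apply: iter_def_le kn _; apply: h.
  by rewrite (lt_le_trans xx1 u) (le_lt_trans v y1y).
have x1y1 : x1 < y1 by apply: lt_trans zy1.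
apply/andP; split.
  have /domP/andP[u _] : dom F (iter k F x1).
    apply: iter_dom; last by apply: h'; rewrite lexx ltW.
    by apply/domP; rewrite ax1 (le_trans (ltW x1y1)).
  apply: le_lt_trans u _; apply: iter_mono => //.
    by rewrite (le_trans (ltW zy1)).
  by move=> w /andP[u v]; apply: h'; rewrite u (le_trans v (ltW zy1)).
have /domP/andP[_ u] : dom F (iter k F y1).
  apply: iter_dom; last by apply: h'; rewrite lexx ltW.
  by apply/domP; rewrite y1b (le_trans ax1 (ltW x1y1)).
apply: lt_le_trans u; apply: iter_mono => //.
  by rewrite (le_trans ax1 (ltW _)).
by move=> w /andP[u v]; apply: h'; rewrite v (le_trans (ltW x1z) u).
Qed.

Lemma near_iter n x : dom F x -> iter_def F n x ->
  iter n F y @[y --> within (dom F) (nbhs x)] --> iter n F x /\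
  \forall y \near x, dom F y -> iter_def F n y.
Proof.
elim: n x => [|n IH] x dx.
  by move=> _; split; [exact: cvg_within|exact: filterE].
move=> /iter_defS[xc h].
have dFx := lorenz_dom dx xc.
have [/cvg_withinP IH1 IH2] := IH _ dFx h.
have xcn : \forall y \near x, y != c := near_neq xc.
have /cvg_withinP cF := cvg_lorenz dx xc.
split.
  apply/cvg_withinP => U; rewrite iterSr => /IH1/cF.
  apply: filterS2 xcn => y yc hy dy; rewrite iterSr.
  by apply: hy => //; apply: lorenz_dom.
have := cF _ IH2; apply: filterS2 xcn => y yc hy dy.
apply/iter_defS; split => //; apply: hy => //; exact: lorenz_dom.
Qed.

End Lorenz.

Lemma nbhs_itvP {R : realType} (x : R) (U : set R) :
  nbhs x U <-> exists2 e : R, 0 < e & forall y, x - e < y < x + e -> U y.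
Proof.
split=> [/nbhs_ballP[e e0 h]|[e e0 h]].
  exists e => // y hy; apply: h; rewrite /ball /= distrC ltr_distl; lra.
apply/nbhs_ballP; exists e => //= y; rewrite /ball /= distrC ltr_distl => hy.
by apply: h.
Qed.

(** * Reflection x |-> - x *)

Section Flip.
Context {R : realType}.
Implicit Types (F G : pmap R) (A E U : set R) (x y z : R) (n k l r : nat).

(** Conjugation by the reflection exchanges the two branches and the points c- and c+; statements to
    the right of c are deduced from those to the left. *)
Definition flip F : pmap R :=
  PMap (fun x => - F (- x)) (- hi F) (- lo F) (- disc F).

Lemma iter_flip F n x : iter n (flip F) x = - iter n F (- x).
Proof. by elim: n => [|n IH] /=; rewrite ?opprK // IH opprK. Qed.

Lemma iter_def_flip F n x : iter_def (flip F) n x <-> iter_def F n (- x).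
Proof.
by split=> h j /h; rewrite iter_flip /= eqr_opp.
Qed.

Lemma dom_flip F x : dom (flip F) x <-> dom F (- x).
Proof. by split=> /domP /= h; apply/domP => /=; lra. Qed.

Lemma lorenz_flip F : is_lorenz F -> is_lorenz (flip F).
Proof.
move=> hF; have cF := lorenz_lt hF.
have cts x : dom (flip F) x -> x != - disc F ->
    flip F y @[y --> within (dom (flip F)) (nbhs x)] --> flip F x.
  move=> /dom_flip dx xc.
  have /(cvg_lorenz hF dx)/cvg_withinP h : - x != disc F by rewrite eqr_oppLR.
  apply/cvg_withinP => U /nbhs_itvP[e e0 hU].
  have /h/nbhs_itvP[d d0 hd] : nbhs (F (- x)) [set y | U (- y)].
    by apply/nbhs_itvP; exists e => // y hy; apply: hU => /=; lra.
  apply/nbhs_itvP; exists d => // y hy /dom_flip dy.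
  by apply: (hd (- y)) => //; lra.
split => /=; first lra.
- move=> x /dom_flip dx xc; apply/dom_flip; rewrite /= opprK.
  by apply: lorenz_dom => //; rewrite eqr_oppLR.
- split.
    apply/subspace_continuousP => x; rewrite /= in_itv /= => hx.
    have dx : dom (flip F) x by apply/domP => /=; lra.
    have xc : x != - disc F by rewrite lt_eqF //; lra.
    have /cvg_withinP h := cts _ dx xc.
    apply/cvg_withinP => U /h; apply: filterS => y hy; rewrite /= in_itv /= => h2.
    by apply: hy; apply/domP => /=; lra.
  move=> x y; rewrite !in_itv /= => hx hy xy; rewrite ltrN2.
  by apply: incR => //; lra.
- split.
    apply/subspace_continuousP => x; rewrite /= in_itv /= => hx.
    have dx : dom (flip F) x by apply/domP => /=; lra.
    have xc : x != - disc F by rewrite gt_eqF //; lra.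
    have /cvg_withinP h := cts _ dx xc.
    apply/cvg_withinP => U /h; apply: filterS => y hy; rewrite /= in_itv /= => h2.
    by apply: hy; apply/domP => /=; lra.
  move=> x y; rewrite !in_itv /= => hx hy xy; rewrite ltrN2.
  by apply: incL => //; lra.
- split; [apply/cvg_at_leftNP|apply/cvg_at_rightNP]; rewrite opprK /=.
    apply: cvg_trans (cvgN (cvgR hF)); apply: near_eq_cvg.
    by apply: filterE => x; rewrite /= opprK.
  apply: cvg_trans (cvgN (cvgL hF)); apply: near_eq_cvg.
  by apply: filterE => x; rewrite /= opprK.
Qed.

(** Density of the preimages of c, stated on intervals and with a first visit to c, so that the
    iterates involved are genuine values. *)
Definition expandingI F := forall x y, lo F <= x -> x < y -> y <= hi F ->
  exists z n, [/\ x < z < y, iter_def F n z & iter n F z = disc F].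

(** The interval is adjacent to [x] on one side, the right one unless [x] is [hi F]; endpoints of
    the domain thus need no separate treatment. *)
Lemma dom_nbhs_itv F x U : lo F < disc F < hi F -> dom F x -> nbhs x U ->
  exists y z, [/\ lo F <= y, y < z, z <= hi F & forall w, y < w < z -> U w].
Proof.
move=> hc /domP/andP[ax xb] /nbhs_itvP[e e0 hU].
case: (ltP x (hi F)) => xb'.
  case: (leP (hi F) (x + e / 2)) => h1.
    by exists x, (hi F); split => // w hw; apply: hU; lra.
  by exists x, (x + e / 2); split; try lra; move=> w hw; apply: hU; lra.
case: (leP (x - e / 2) (lo F)) => h1.
  by exists (lo F), x; split; try lra; move=> w hw; apply: hU; lra.
by exists (x - e / 2), x; split; try lra; move=> w hw; apply: hU; lra.
Qed.

Lemma expandingP F : is_lorenz F -> expanding F <-> expandingI F.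
Proof.
move=> hF; split=> [h x y ax xy yb|h x dx U hU].
  have [xm my] := midf_lt xy; set m := (x + y) / _ in xm my.
  have /h : dom F m by apply/domP; rewrite (le_trans ax (ltW xm)) (le_trans (ltW my)).
  move=> /(_ `]x, y[%classic) [].
    by apply: near_in_itvoo; rewrite in_itv /= xm.
  move=> z [[n _ hz]]; rewrite /= in_itv /= => xzy.
  by have [k [_ h1 h2]] := backward_hit hz; exists z, k.
have [y [z [h1 h2 h3 h4]]] := dom_nbhs_itv (lorenz_lt hF) dx hU.
have [w [n [hw dw ew]]] := h _ _ h1 h2 h3.
exists w; split; last exact: h4.
by exists n => //; apply: backward_iter => //; apply/domP; lra.
Qed.

End Flip.

(** * Invariant sets and their gap around c *)

Section Gaps.
Context {R : realType}.
Implicit Types (F G : pmap R) (A E U : set R) (x y z p q : R) (n k l r : nat).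

(** The working form of [hit_time]: N(U) = n expressed by iterates instead of backward sets. *)
Definition hit F U n := (forall w, U w -> iter_def F n w) /\
  exists2 w, U w & iter n F w = disc F.

(* Backward invariance is required away from the endpoints only: it may fail
   there for alpha-limit sets, which are accumulated from one side. *)
Definition qinv F A := [/\ closed A, A `<=` dom F, ~ A (disc F),
  forall x, A x -> A (F x) &
  forall x, lo F < x < hi F -> x != disc F -> A (F x) -> A x].

Definition left_gap F A p := [/\ A p, p < disc F & forall x, A x -> x < disc F -> x <= p].
Definition right_gap F A q := [/\ A q, disc F < q & forall x, A x -> disc F < x -> q <= x].

(* [left_map] and [right_map] follow the orbits of c- and c+. *)
Definition left_map F x := if x == disc F then hi F else F x.
Definition right_map F x := if x == disc F then lo F else F x.

Definition mirror A : set R := [set x | A (- x)].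

Lemma hit_flip F U n : hit F U n <-> hit (flip F) (mirror U) n.
Proof.
split=> -[h [w Uw hw]]; split.
- by move=> v /h h'; apply/iter_def_flip.
- by exists (- w); rewrite /mirror /= ?opprK // iter_flip opprK hw.
- move=> v Uv; have : mirror U (- v) by rewrite /mirror /= opprK.
  by move=> /h/iter_def_flip; rewrite opprK.
- exists (- w) => //; apply: oppr_inj; by rewrite -iter_flip hw.
Qed.

Lemma mirror_itv x y : mirror `]x, y[%classic = `]- y, - x[%classic.
Proof. by apply/seteqP; split=> z; rewrite /mirror /= !in_itv /=; lra. Qed.

Lemma qinv_flip F A : qinv F A -> qinv (flip F) (mirror A).
Proof.
case=> h1 h2 h3 h4 h5; split.
- by apply: closed_comp h1 => x _; exact: opp_continuous.
- by move=> x /h2 hx; apply/dom_flip.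
- by rewrite /mirror /= opprK.
- by move=> x /h4; rewrite /mirror /= opprK.
- move=> x /= hx xc; rewrite /mirror /= opprK; apply: h5; first lra.
  by rewrite eqr_oppLR.
Qed.

Lemma gap_flip F A p : right_gap F A p <-> left_gap (flip F) (mirror A) (- p).
Proof.
rewrite /right_gap /left_gap /mirror /= opprK.
split=> -[h1 h2 h3]; split; [exact: h1|lra| |exact: h1|lra|].
- by move=> x hx xc; have := h3 _ hx; lra.
- by move=> x hx xc; have := h3 (- x); rewrite opprK => /(_ hx); lra.
Qed.

Lemma expandingI_flip F : expandingI F -> expandingI (flip F).
Proof.
move=> h x y /= ax xy yb.
have [|||z [n [hz h1 h2]]] := h (- y) (- x); [lra..|].
exists (- z), n; split; first lra.
  by apply/iter_def_flip; rewrite opprK.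
by rewrite iter_flip opprK h2.
Qed.

Lemma iter_right_map F n x :
  iter n (right_map F) x = - iter n (left_map (flip F)) (- x).
Proof.
elim: n => [|n IH] /=; first by rewrite opprK.
by rewrite IH /right_map /left_map /= eqr_oppLR; case: ifP; rewrite ?opprK.
Qed.

Lemma left_gap_ex F A x : closed A -> ~ A (disc F) -> A x -> x < disc F ->
  exists p, left_gap F A p.
Proof.
move=> cA nA Ax xc; pose S := [set y | A y /\ y < disc F].
have S0 : S !=set0 by exists x.
have uS : has_ubound S by exists (disc F) => y [_ /ltW].
have /(closure_sup S0) hs := uS.
have As : A (sup S) by apply: cA; apply: closure_subset hs => y [].
have : sup S <= disc F by apply: ge_sup => // y [_ /ltW].
rewrite le_eqVlt => /orP[/eqP e|sc]; first by rewrite e in As.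
exists (sup S); split => // y Ay yc; by apply: ub_le_sup.
Qed.

Lemma right_gap_ex F A x : closed A -> ~ A (disc F) -> A x -> disc F < x ->
  exists q, right_gap F A q.
Proof.
move=> cA nA Ax xc.
have [||||p hp] := @left_gap_ex (flip F) (mirror A) (- x).
- by apply: closed_comp cA => y _; exact: opp_continuous.
- by rewrite /mirror /= opprK.
- by rewrite /mirror /= opprK.
- by rewrite /=; lra.
by exists (- p); apply/gap_flip; rewrite opprK.
Qed.

Lemma left_gap_unique F A B p p' : left_gap F A p -> left_gap F B p' ->
  A p' -> B p -> p = p'.
Proof.
move=> [h1 h2 h3] [k1 k2 k3] u v; apply/eqP; rewrite eq_le.
by rewrite k3 // h3.
Qed.

Lemma right_gap_unique F A B p p' : right_gap F A p -> right_gap F B p' ->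
  A p' -> B p -> p = p'.
Proof.
move=> [h1 h2 h3] [k1 k2 k3] u v; apply/eqP; rewrite eq_le.
by rewrite k3 // h3.
Qed.

Lemma e_minusE F A p : left_gap F A p -> e_minus F A = p.
Proof.
move=> [h1 h2 h3]; apply/eqP; rewrite eq_le; apply/andP; split.
  by apply: ge_sup; [exists p|move=> x []; exact: h3].
by apply: ub_le_sup => //; exists p => x []; exact: h3.
Qed.

Lemma e_plusE F A p : right_gap F A p -> e_plus F A = p.
Proof.
move=> [h1 h2 h3]; apply/eqP; rewrite eq_le; apply/andP; split.
  by apply: ge_inf => //; exists p => x []; exact: h3.
by apply: lb_le_inf; [exists p|move=> x []; exact: h3].
Qed.

Lemma qinv_iter F A n x : qinv F A -> A x -> A (iter n F x).
Proof. by case=> _ _ _ h _; elim: n => [//|n IH] /IH /h. Qed.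

Lemma qinv_iter_def F A n x : qinv F A -> A x -> iter_def F n x.
Proof.
move=> hA Ax j _; apply/eqP => e; case: (hA) => _ _ + _ _; apply.
by rewrite -e; exact: qinv_iter.
Qed.

Lemma qinv_iter_back F A n x : qinv F A -> iter_def F n x ->
  (forall j, (j < n)%N -> lo F < iter j F x < hi F) -> A (iter n F x) -> A x.
Proof.
move=> hA; elim: n x => [//|n IH] x /iter_defS[xc hx] h; rewrite iterSr => hn.
case: (hA) => _ _ _ _; apply => //; first exact: (h 0%N).
by apply: IH => // j jn; rewrite -iterSr; apply: h.
Qed.

End Gaps.

(** * Consequences of expansion *)

Section Expanding.
Context {R : realType}.
Context (F : pmap R).
Context (hF : is_lorenz F) (eF : expandingI F).
Implicit Types (A E U : set R) (x y z p q : R) (n k l r : nat).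
Local Notation c := (disc F).

Lemma hit_ex U x y : lo F <= x -> x < y -> y <= hi F ->
  (forall z, x < z < y -> U z) -> exists n, hit F U n.
Proof.
move=> ax xy yb hU.
have [z [n [hz h1 h2]]] := eF ax xy yb.
pose P n := `[< exists2 w, U w & iter n F w = c >].
have exP : exists n, P n by exists n; apply/asboolP; exists z => //; exact: hU.
case: (ex_minnP exP) => m /asboolP hm min; exists m; split => // w Uw j jm.
apply/eqP => e; have : (m <= j)%N by apply: min; apply/asboolP; exists w.
by rewrite leqNgt jm.
Qed.

Lemma never_hits x y : lo F <= x -> x < y -> y <= hi F ->
  ~ (forall z n, x < z < y -> iter_def F n z).
Proof.
move=> ax xy yb h; have [z [n [hz _ e]]] := eF ax xy yb.
by have := h z n.+1 hz n (leqnn _); rewrite e eqxx.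
Qed.

(** If f^l mapped the interval into itself without meeting c on the way, repeating this block of [l]
    steps would keep its points off c forever. *)
Lemma no_trapped_itv l x y : (0 < l)%N -> lo F <= x -> x < y -> y <= hi F ->
  ~ (forall z, x < z < y -> iter_def F l z /\ x < iter l F z < y).
Proof.
move=> l0 ax xy yb h; apply: (never_hits ax xy yb) => z n.
elim/ltn_ind: n z => n IH z /h[h1 h2].
case: (leqP n l) => [nl|ln]; first exact: iter_def_le h1.
rewrite -(subnKC (ltnW ln)); apply/iter_defD; split => //.
by apply: IH => //; rewrite ltn_subrL l0 (leq_ltn_trans _ ln).
Qed.

(** A fixed point of the left branch would trap the interval between [lo F] and [p], because F(lo)
    >= lo and [F] increases there. This is what rules out return time 1. *)
Lemma no_fixL p : lo F < p -> p < c -> F p != p.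
Proof.
move=> ap pc; apply/eqP => e.
apply: (@no_trapped_itv 1 (lo F) p) => //.
  by apply: ltW; apply: lt_trans (lorenz_hi hF).
move=> z /andP[az zp]; have zc := lt_trans zp pc; split.
  by apply/iter_defS; split => //; rewrite lt_eqF.
rewrite /= -[X in _ < _ < X]e incL // ?(ltW az) // andbT.
apply: le_lt_trans (incL hF (lexx _) az zc).
have /domP/andP[//] : dom F (F (lo F)).
apply: (lorenz_dom hF); last by rewrite lt_eqF // lorenz_lo.
by apply/domP; have := lorenz_lt hF; lra.
Qed.

Lemma iter_monoL p l x y : lo F <= p -> (forall z, p <= z < c -> iter_def F l z) ->
  p <= x -> x < y -> y < c -> iter l F x < iter l F y.
Proof.
move=> ap h px xy yc; apply: (iter_mono hF) => //; first exact: le_trans px.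
  by apply: ltW (lt_trans yc (lorenz_hi hF)).
by move=> z /andP[u v]; apply: h; rewrite (le_trans px u) (le_lt_trans v).
Qed.

(** Before the passage over c, interior points of the interval stay off the endpoints of the domain,
    the only places where [qinv] gives no backward invariance. *)
Lemma qinv_open_back A n x y z : qinv F A -> lo F <= x -> y <= hi F ->
  (forall w, x < w < y -> iter_def F n w) -> x < z < y -> A (iter n F z) -> A z.
Proof.
move=> hA ax yb h /andP[xz zy]; apply: qinv_iter_back => //.
  by apply: h; rewrite xz.
by move=> j /ltnW jn; apply: (iter_inside hF jn ax xz zy yb).
Qed.

End Expanding.

(** * Return maps of the gap *)

Section LeftMap.
Context {R : realType}.
Context (F : pmap R).
Context (hF : is_lorenz F).
Implicit Types (A E U : set R) (x y z p q : R) (n k l r : nat).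
Local Notation c := (disc F).

(** Monotonicity turns an approach from the left into an approach from the left. Convergence to the
    left filter, and not merely to the point, is what can be iterated. *)
Lemma cvg_left_map z : lo F < z <= hi F ->
  F x @[x --> z^'-] --> (left_map F z)^'- /\ lo F < left_map F z <= hi F.
Proof.
move=> /andP[az zb]; rewrite /left_map; case: eqVneq => [->|zc].
  split; last by have := lorenz_lt hF; lra.
  move=> U /nbhs_itvP[e e0 hU].
  change (\forall y \near c^'-, U (F y)).
  have h1 : \forall y \near c^'-, hi F - e < F y.
    by apply: (cvgr_gt _ (cvgL hF)); lra.
  near=> y.
  have yb : F y < hi F.
    apply: (ltL hF); last by near: y; exact: nbhs_left_lt.
    by apply: ltW; near: y; apply: nbhs_left_gt; exact: lorenz_lo.
  apply: hU => //; have : hi F - e < F y by near: y.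
  lra.
have dz : dom F z by apply/domP; lra.
(* [x0] is the left end of the branch containing [z]: [lo F] or c. *)
have [x0 [ax0 x0z x0c]] : exists x0, [/\ lo F <= x0, x0 < z & (z < c) || (c <= x0)].
  move: zc; rewrite neq_lt => /orP[zc|cz].
    by exists (lo F); rewrite zc.
  by exists c; rewrite lexx orbT; split => //; apply: ltW; exact: lorenz_lo.
have mono y : x0 < y -> y < z -> F y < F z.
  move=> x0y yz; case/orP: x0c => h.
    by apply: incL => //; lra.
  by apply: incR => //; lra.
split.
  move=> U /nbhs_itvP[e e0 hU].
  change (\forall y \near z^'-, U (F y)).
  have /cvg_withinP h := cvg_lorenz hF dz zc.
  have /h h1 : nbhs (F z) [set y | F z - e < y < F z + e] by apply/nbhs_itvP; exists e.
  near=> y; have yz : y < z by near: y; exact: nbhs_left_lt.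
  have x0y : x0 < y by near: y; exact: nbhs_left_gt.
  apply: hU; last exact: mono.
  have : dom F y -> F z - e < F y < F z + e by near: y; apply: cvg_within h1.
  by apply; apply/domP; lra.
have [h1 h2] := midf_lt x0z; have := mono _ h1 h2.
set m := (x0 + z) / _ in h1 h2 *.
have /domP : dom F (F m).
  apply: lorenz_dom => //; first by apply/domP; lra.
  by case/orP: x0c => h; [rewrite lt_eqF//|rewrite gt_eqF//]; lra.
have /domP : dom F (F z) by apply: lorenz_dom.
lra.
Unshelve. all: by end_near. Qed.

Lemma cvg_iter_left n z : lo F < z <= hi F ->
  iter n F x @[x --> z^'-] --> (iter n (left_map F) z)^'- /\
  lo F < iter n (left_map F) z <= hi F.
Proof.
move=> hz; elim: n => [|n [IH1 IH2]] /=; first by split => //; exact: cvg_id.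
have [h1 h2] := cvg_left_map IH2; split => //.
exact: cvg_comp IH1 h1.
Qed.

Lemma cvg_iter_disc n : iter n F x @[x --> c^'-] --> (iter n (left_map F) c)^'-.
Proof. by have [] := @cvg_iter_left n c; first by have := lorenz_lt hF; lra. Qed.

Lemma iter_left_lt n p : p < c ->
  exists x, [/\ p < x, x < c & iter n F x < iter n (left_map F) c].
Proof.
move=> pc; apply: (@filter_ex _ c^'-); near=> y; split; near: y.
- exact: nbhs_left_gt.
- exact: nbhs_left_lt.
- exact: (@cvg_iter_disc n _ (nbhs_left_lt _)).
Unshelve. all: by end_near. Qed.

(** Identifies the orbit of c under [left_map] with the one-sided limits f^n(c-). *)
Lemma cvg_left_value n : iter n F x @[x --> c^'-] --> iter n (left_map F) c.
Proof. exact: cvg_trans (@cvg_iter_disc n) (cvg_within _). Qed.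

(** Rests on the convention that c is a preimage of [hi F]. It later keeps the endpoints of
    renormalization intervals out of the invariant sets. *)
Lemma backward_left n : backward F n (iter n (left_map F) c) c.
Proof.
suff H z : dom F z -> backward F n (iter n (left_map F) z) z by apply/H/disc_dom.
elim: n z => [//|n IH] z dz; apply/backwardS; exists (left_map F z).
  rewrite iterSr; apply: IH; rewrite /left_map; case: eqVneq => [_|zc].
    by apply/domP; have := lorenz_lt hF; lra.
  exact: lorenz_dom.
split => //; rewrite /left_map; case: eqVneq => [zc|zc]; [right|left]; split=> //.
by right.
Qed.

End LeftMap.

Section Renewal.
Context {R : realType}.
Context (F : pmap R).
Context (hF : is_lorenz F) (eF : expandingI F).
Implicit Types (E U : set R) (x y z q : R) (n k r : nat).
Local Notation c := (disc F).
Context (A : set R) (p : R) (l : nat).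
Context (hA : qinv F A) (gp : left_gap F A p) (ap : lo F < p)
  (hl : hit F `]p, c[%classic l).

Let pc : p < c. Proof. by case: gp. Qed.
Let cb : c < hi F. Proof. exact: lorenz_hi. Qed.

Lemma renewal_def z : p <= z < c -> iter_def F l z.
Proof.
move=> /andP[]; rewrite le_eqVlt => /orP[/eqP<- _|pz zc].
  by case: gp => Ap _ _; exact: (@qinv_iter_def _ _ _ _ _ hA Ap).
by case: hl => h _; apply: h; rewrite /= in_itv /= pz.
Qed.

Lemma renewal_mono x y : p <= x -> x < y -> y < c -> iter l F x < iter l F y.
Proof. exact: (iter_monoL hF (ltW ap) renewal_def). Qed.

(** Backward invariance would put [z] itself in [A], inside the gap. *)
Lemma renewal_notin z : p < z < c -> ~ A (iter l F z).
Proof.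
move=> pzc hz; case: gp => _ _ max; case/andP: (pzc) => pz zc.
suff /max : A z by move=> /(_ zc); rewrite leNgt pz.
apply: (qinv_open_back hF hA (ltW ap) (ltW cb) (n := l)) hz => // w /andP[pw wc].
by apply: renewal_def; rewrite ltW.
Qed.

(** The image of [p] is in [A] and to the left of the image c of [w], hence at most [p]. If it were
    smaller, the intermediate value theorem would give a point of the gap sent to [p], against
    [renewal_notin]. *)
Lemma renewal_fix : iter l F p = p.
Proof.
have [Ap _ max] := gp; have [_ [w /= + ew]] := hl.
rewrite in_itv /= => /andP[pw wc].
have h1 : iter l F p < c by rewrite -ew; apply: renewal_mono.
have : iter l F p <= p by apply: max => //; exact: (qinv_iter _ hA Ap).
rewrite le_eqVlt => /orP[/eqP//|lp].
have [|||z /andP[]] := @iter_ivt _ _ hF l p w p (ltW ap) (ltW pw).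
- by apply: ltW (lt_trans wc cb).
- by move=> z /andP[u v]; apply: renewal_def; rewrite u (le_lt_trans v).
- by rewrite (ltW lp) ew ltW.
rewrite le_eqVlt => /orP[/eqP<-//|pz zw ez].
by case: (@renewal_notin z); rewrite ?ez // pz (le_lt_trans zw).
Qed.

(** Time 0 would put c in ]p, c[, and time 1 would make [p] a fixed point of the left branch. *)
Lemma renewal_gt1 : (1 < l)%N.
Proof.
case: l hl renewal_fix => [|[|//]].
  by case=> _ [w /=]; rewrite in_itv /= => /andP[_ +] e; rewrite e ltxx.
by move=> _ /eqP; rewrite /= (negbTE (no_fixL hF eF ap pc)).
Qed.

(** Otherwise f^l, increasing with fixed point [p], would trap ]p, x[. *)
Lemma renewal_up x : p < x < c -> x < iter l F x.
Proof.
move=> /andP[px xc]; rewrite ltNge; apply/negP => le.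
apply: (@no_trapped_itv _ _ eF l p x) => //.
- by apply: ltnW renewal_gt1.
- exact: ltW.
- by apply: ltW (lt_trans xc cb).
move=> z /andP[pz zx]; split.
  by apply: renewal_def; rewrite ltW //= (lt_trans zx).
rewrite -[X in X < _ < _]renewal_fix renewal_mono ?(lt_trans zx) //=.
by apply: lt_le_trans le; apply: renewal_mono => //; apply: ltW.
Qed.

(** The image of ]p, c[ contains c and misses [A], so it cannot reach [q]. In the limit f^l(c-) is
    at most [q], which puts the renormalization interval inside [p, q]. *)
Lemma renewal_below x q : right_gap F A q -> p < x < c -> iter l F x < q.
Proof.
move=> [Aq cq _] /andP[px xc]; rewrite ltNge; apply/negP => le.
have [_ [w /= + ew]] := hl; rewrite in_itv /= => /andP[pw wc].
have wx : w <= x.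
  rewrite leNgt; apply/negP => xw; have := renewal_mono (ltW px) xw wc.
  by rewrite ew; lra.
have aw : lo F <= w by rewrite ltW // (lt_trans ap).
have [|||z /andP[wz zx] ez] := @iter_ivt _ _ hF l w x q aw wx.
- by apply: ltW (lt_trans xc cb).
- move=> z /andP[u v]; apply: renewal_def; rewrite (le_lt_trans v) // andbT.
  by rewrite ltW // (lt_le_trans pw).
- by rewrite ew le ltW.
by case: (@renewal_notin z); rewrite ?ez // (lt_le_trans pw wz) (le_lt_trans zx).
Qed.

Lemma renewal_lt_left x : p <= x < c -> iter l F x < iter l (left_map F) c.
Proof.
move=> /andP[px xc]; have [y [xy yc h]] := iter_left_lt hF l xc.
by apply: lt_trans h; apply: renewal_mono.
Qed.

Lemma renewal_left_gt : c < iter l (left_map F) c.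
Proof.
have [_ [w /= + ew]] := hl; rewrite in_itv /= => /andP[pw wc].
by rewrite -[X in X < _]ew; apply: renewal_lt_left; rewrite ltW.
Qed.

Lemma renewal_left_le q : right_gap F A q -> iter l (left_map F) c <= q.
Proof.
move=> gq; rewrite leNgt; apply/negP => h.
have : \forall y \near c^'-, False; last by move=> /filter_ex[].
near=> y.
have : iter l F y < q.
  apply: renewal_below => //; apply/andP; split; near: y; last exact: nbhs_left_lt.
  exact: nbhs_left_gt.
by apply/negP; rewrite -leNgt ltW //; near: y; exact: (cvgr_gt _ (@cvg_left_value _ _ hF l)).
Unshelve. all: by end_near. Qed.

Lemma renewal_cvg x : p <= x < c ->
  iter l F y @[y --> within (dom F) (nbhs x)] --> iter l F x.
Proof.
move=> pxc; have dx : dom F x by apply/domP; have := lorenz_lt hF; have := ap; lra.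
by case: (near_iter hF dx (renewal_def pxc)).
Qed.

End Renewal.

Section RenewalRight.
Context {R : realType}.
Context (F : pmap R).
Context (hF : is_lorenz F) (eF : expandingI F).
Implicit Types (E U : set R) (x y z p : R) (n k l : nat).
Local Notation c := (disc F).
Context (A : set R) (q : R) (r : nat).
Context (hA : qinv F A) (gq : right_gap F A q) (qb : q < hi F)
  (hr : hit F `]c, q[%classic r).

Let hF' : is_lorenz (flip F) := lorenz_flip hF.
Let eF' : expandingI (flip F) := expandingI_flip eF.
Let hA' : qinv (flip F) (mirror A) := qinv_flip hA.
Let gq' : left_gap (flip F) (mirror A) (- q).
Proof. exact/gap_flip. Qed.
Let qb' : lo (flip F) < - q.
Proof. by rewrite /= ltrN2. Qed.
Let hr' : hit (flip F) `]- q, disc (flip F)[%classic r.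
Proof. by rewrite /= -mirror_itv -hit_flip. Qed.

Lemma renewal_def_right z : c < z <= q -> iter_def F r z.
Proof.
move=> hz; have /iter_def_flip : iter_def (flip F) r (- z).
  by apply: (renewal_def hA' gq' hr') => /=; lra.
by rewrite opprK.
Qed.

Lemma renewal_mono_right x y : c < x -> x < y -> y <= q -> iter r F x < iter r F y.
Proof.
move=> cx xy yq; have := @renewal_mono _ _ hF' _ _ _ hA' gq' qb' hr' (- y) (- x).
by rewrite /= !iter_flip !opprK !ltrN2 lerN2; apply.
Qed.

Lemma renewal_fix_right : iter r F q = q.
Proof.
have := renewal_fix hF' hA' gq' qb' hr'.
by rewrite iter_flip opprK => /oppr_inj.
Qed.

Lemma renewal_gt1_right : (1 < r)%N.
Proof. exact: (renewal_gt1 hF' eF' hA' gq' qb' hr'). Qed.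

Lemma renewal_down x : c < x < q -> iter r F x < x.
Proof.
move=> h; have := @renewal_up _ _ hF' eF' _ _ _ hA' gq' qb' hr' (- x).
by rewrite iter_flip opprK /= !ltrN2 andbC; apply.
Qed.

Lemma renewal_gt_right x : c < x <= q -> iter r (right_map F) c < iter r F x.
Proof.
move=> h; have := @renewal_lt_left _ _ hF' _ _ _ hA' gq' qb' hr' (- x).
rewrite iter_flip opprK /= => h1; rewrite iter_right_map ltrNl; apply: h1; lra.
Qed.

Lemma renewal_right_lt : iter r (right_map F) c < c.
Proof.
have := renewal_left_gt hF' hA' gq' qb' hr'.
by rewrite /= iter_right_map => h; lra.
Qed.

Lemma renewal_right_ge p : left_gap F A p -> p <= iter r (right_map F) c.
Proof.
move=> [h1 h2 h3].
have := @renewal_left_le _ _ hF' _ _ _ hA' gq' qb' hr' (- p).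
rewrite /= iter_right_map lerNr; apply; split => /=.
- by rewrite /mirror /= opprK.
- by rewrite ltrN2.
- by move=> x Ax cx; rewrite lerNl; apply: h3 => //; lra.
Qed.

Lemma renewal_cvg_right x : c < x <= q ->
  iter r F y @[y --> within (dom F) (nbhs x)] --> iter r F x.
Proof.
move=> h; have dx : dom F x by apply/domP; have := lorenz_lt hF; have := qb; lra.
by case: (near_iter hF dx (renewal_def_right h)).
Qed.

End RenewalRight.

Section RightMap.
Context {R : realType}.
Context (F : pmap R).
Context (hF : is_lorenz F).
Local Notation c := (disc F).

Lemma cvg_right_value n : iter n F x @[x --> c^'+] --> iter n (right_map F) c.
Proof.
apply/cvg_at_rightNP; rewrite iter_right_map.
apply: cvg_trans (cvgN (@cvg_left_value _ _ (lorenz_flip hF) n)).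
apply: near_eq_cvg; apply: filterE => x.
by change (- iter n (flip F) x = iter n F (- x)); rewrite iter_flip opprK.
Qed.

Lemma backward_right n : backward F n (iter n (right_map F) c) c.
Proof.
suff H z : dom F z -> backward F n (iter n (right_map F) z) z by apply/H/disc_dom.
elim: n z => [//|n IH] z dz; apply/backwardS; exists (right_map F z).
  rewrite iterSr; apply: IH; rewrite /right_map; case: eqVneq => [_|zc].
    by apply/domP; have := lorenz_lt hF; lra.
  exact: lorenz_dom.
split => //; rewrite /right_map; case: eqVneq => [zc|zc]; [right|left]; split=> //.
by left.
Qed.

Lemma surjR x t : c < x -> x <= hi F -> lo F < t -> t <= F x ->
  exists2 z, c < z <= x & F z = t.
Proof.
move=> cx xb at_ tx.
have [||||z hz ez] := @surjL _ _ (lorenz_flip hF) (- x) (- t) => /=.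
- by rewrite lerN2.
- by rewrite ltrN2.
- by rewrite opprK lerN2.
- by rewrite ltrN2.
by exists (- z); [move: hz => /=; lra|apply: oppr_inj].
Qed.

Lemma no_fixR (eF : expandingI F) q : c < q -> q < hi F -> F q != q.
Proof.
move=> cq qb; have := @no_fixL _ _ (lorenz_flip hF) (expandingI_flip eF) (- q).
by rewrite /= opprK eqr_opp !ltrN2; apply.
Qed.

End RightMap.

(** * Gaps on both sides of c and the renormalization they define *)

Section QInv.
Context {R : realType}.
Context (F : pmap R).
Context (hF : is_lorenz F) (eF : expandingI F).
Implicit Types (A E U : set R) (x y z p q : R) (n k l r : nat).
Local Notation c := (disc F).

(** Suppose [x] is to the right of c and let [q] be the point of [A] nearest to c on that side.
    Either F(q) is to the left of c, or F(q) >= q; then [q] has a preimage in ]c, q], which belongs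
    to [A] and so equals [q], a fixed point excluded by [no_fixR]. *)
Lemma qinv_meetL A x : qinv F A -> A x -> lo F < x < hi F ->
  exists2 y, A y & lo F < y < c.
Proof.
move=> hA Ax /andP[ax xb]; have [cA _ nA fA bA] := hA.
have ne y : A y -> y != c by move=> Ay; apply/eqP => e; rewrite e in Ay.
have := ne _ Ax; rewrite neq_lt => /orP[xc|cx]; first by exists x; rewrite ?ax.
have [q [Aq cq min]] := right_gap_ex cA nA Ax cx.
have qx := min _ Ax cx.
have qb : q < hi F by apply: le_lt_trans xb.
have AFq := fA _ Aq; have aFq := gtR hF cq (ltW qb).
have := ne _ AFq; rewrite neq_lt => /orP[Fc|cF]; first by exists (F q); rewrite ?aFq.
have qF := min _ AFq cF.
have [z /andP[cz zq] ez] := surjR hF cq (ltW qb) (lt_trans (lorenz_lo hF) cq) qF.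
have Az : A z.
  apply: bA; last by rewrite ez.
    by rewrite (lt_trans (lorenz_lo hF) cz) (le_lt_trans zq).
  by rewrite gt_eqF.
have ezq : z = q by apply/eqP; rewrite eq_le zq min.
by have := no_fixR hF eF cq qb; rewrite -{1}ezq ez eqxx.
Qed.

End QInv.

Section QInvRenorm.
Context {R : realType}.
Context (F : pmap R).
Context (hF : is_lorenz F) (eF : expandingI F).
Implicit Types (A E U : set R) (x y z p q : R) (n k l r : nat).
Local Notation c := (disc F).

Lemma qinv_gaps A x : qinv F A -> A x -> lo F < x < hi F ->
  exists p q l r, [/\ left_gap F A p, right_gap F A q, lo F < p < c, c < q < hi F &
    hit F `]p, c[%classic l /\ hit F `]c, q[%classic r].
Proof.
move=> hA Ax hx; have [cA _ nA _ _] := hA; have hc := lorenz_lt hF.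
have [y Ay /andP[ay yc]] := qinv_meetL hF eF hA Ax hx.
have [||y' Ay' hy'] := qinv_meetL (lorenz_flip hF) (expandingI_flip eF)
  (qinv_flip hA) (x := - x) => //.
- by rewrite /mirror /= opprK.
- by rewrite /=; lra.
have [p gp] := left_gap_ex cA nA Ay yc.
have [|q gq] := right_gap_ex cA nA Ay'; first by move: hy' => /=; lra.
have [Ap pc maxp] := gp; have [Aq cq minq] := gq.
have yp := maxp _ Ay yc.
have qy : q <= - y' by apply: minq => //; move: hy' => /=; lra.
move: hy' => /= hy'.
have [|||z|l hl] := hit_ex eF (U := `]p, c[%classic) (x := p) (y := c); try lra.
  by rewrite /= in_itv /=.
have [|||z|r hr] := hit_ex eF (U := `]c, q[%classic) (x := c) (y := q); try lra.
  by rewrite /= in_itv /=.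
by exists p, q, l, r; split => //; lra.
Qed.

Lemma gaps_renorm A p q l r : qinv F A -> left_gap F A p -> right_gap F A q ->
  lo F < p -> q < hi F ->
  hit F `]p, c[%classic l -> hit F `]c, q[%classic r ->
  exists G, renorm F l r G.
Proof.
move=> hA gp gq ap qb hl hr.
have [Ap pc _] := gp; have [Aq cq _] := gq; have hc := lorenz_lt hF.
(* The interval is [f^r(c+), f^l(c-)], contained in [p, q]. *)
pose u := iter r (right_map F) c; pose v := iter l (left_map F) c.
have pu : p <= u := renewal_right_ge hF hA gq qb hr gp.
have vq : v <= q := renewal_left_le hF hA gp ap hl gq.
have uc : u < c := renewal_right_lt hF hA gq qb hr.
have cv : c < v := renewal_left_gt hF hA gp ap hl.
have ltv : forall x, p <= x < c -> iter l F x < v := renewal_lt_left hF hA gp ap hl.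
have gtu : forall x, c < x <= q -> u < iter r F x := renewal_gt_right hF hA gq qb hr.
(* The inequality is not strict because u = p is possible: for a set that is only [qinv], the return
   map may fix an endpoint of its interval. *)
have up x : p <= x < c -> x <= iter l F x.
  move=> /andP[]; rewrite le_eqVlt => /orP[/eqP<- _|px xc].
    by rewrite (renewal_fix hF hA gp ap hl).
  by apply/ltW/(renewal_up hF eF hA gp ap hl); rewrite px.
have down x : c < x <= q -> iter r F x <= x.
  move=> /andP[cx]; rewrite le_eqVlt => /orP[/eqP->|xq].
    by rewrite (renewal_fix_right hF hA gq qb hr).
  by apply/ltW/(renewal_down hF eF hA gq qb hr); rewrite cx.
pose g x := if x < c then iter l F x else iter r F x.
have gL x : x < c -> g x = iter l F x by rewrite /g => ->.
have gR x : c < x -> g x = iter r F x by move=> cx; rewrite /g ltNge (ltW cx).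
exists (PMap g u v c); split.
- by rewrite (renewal_gt1 hF eF hA gp ap hl) (renewal_gt1_right hF eF hA gq qb hr).
- split => //; split; first by move=> x /domP /= hx; apply/domP; lra.
  move=> /(_ (lo F)) h; have : dom F (lo F) by apply/domP; lra.
  by move=> /h/domP /=; lra.
- move=> x /= hx; split; first by apply: (renewal_def hA gp hl); lra.
  by apply: gL; lra.
- move=> x /= hx; split; first by apply: (renewal_def_right hA gq hr); lra.
  by apply: gR; lra.
- split => /=.
  + by rewrite uc.
  + move=> x /domP /= hx; rewrite neq_lt => /orP[xc|cx]; apply/domP => /=.
      rewrite gL //; have h1 : p <= x < c by lra.
      by have := ltv _ h1; have := up _ h1; lra.
    rewrite gR //; have h1 : c < x <= q by lra.
    by have := gtu _ h1; have := down _ h1; lra.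
  + split.
      apply/subspace_continuousP => x /=; rewrite in_itv /= => hx.
      have h1 : p <= x < c by lra.
      have /cvg_withinP h := renewal_cvg hF hA gp ap hl h1.
      apply/cvg_withinP => U hU.
      have /h : nbhs (iter l F x) U by rewrite -gL; [exact: hU|lra].
      apply: filterS => y hy; rewrite /= in_itv /= => hy2.
      by change (U (g y)); rewrite gL; [apply: hy; apply/domP; lra|lra].
    move=> x y; rewrite !in_itv /= => hx hy xy; rewrite !gL; try lra.
    by apply: (renewal_mono hF hA gp ap hl) => //; lra.
  + split.
      apply/subspace_continuousP => x /=; rewrite in_itv /= => hx.
      have h1 : c < x <= q by lra.
      have /cvg_withinP h := renewal_cvg_right hF hA gq qb hr h1.
      apply/cvg_withinP => U hU.
      have /h : nbhs (iter r F x) U by rewrite -gR; [exact: hU|lra].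
      apply: filterS => y hy; rewrite /= in_itv /= => hy2.
      by change (U (g y)); rewrite gR; [apply: hy; apply/domP; lra|lra].
    move=> x y; rewrite !in_itv /= => hx hy xy; rewrite !gR; try lra.
    by apply: (renewal_mono_right hF hA gq qb hr) => //; lra.
  + split.
      apply: cvg_trans (@cvg_left_value _ _ hF l); apply: near_eq_cvg.
      near=> x; rewrite gL //; near: x; exact: nbhs_left_lt.
    apply: cvg_trans (@cvg_right_value _ _ hF r); apply: near_eq_cvg.
    near=> x; rewrite gR //; near: x; exact: nbhs_right_gt.
Unshelve. all: by end_near. Qed.

End QInvRenorm.

Lemma nbhs_sub_itv {R : realType} (a b z : R) (U : set R) : nbhs z U -> a < z < b ->
  exists x y, [/\ a < x, x < z, z < y, y < b & forall w, x <= w <= y -> U w].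
Proof.
move=> hU azb; have h : nbhs z (U `&` `]a, b[%classic).
  by apply: filterI => //; apply: near_in_itvoo; rewrite in_itv.
have [e e0 he] := (nbhs_itvP _ _).1 h.
have [_ ] : (U `&` `]a, b[%classic) (z - e / 2) by apply: he; lra.
have [_ ] : (U `&` `]a, b[%classic) (z + e / 2) by apply: he; lra.
rewrite /= !in_itv /= => h1 h2.
exists (z - e / 2), (z + e / 2); split; try lra.
by move=> w hw; have [] // : (U `&` `]a, b[%classic) w by apply: he; lra.
Qed.

(** * Alpha-limit sets *)

Section Alpha.
Context {R : realType}.
Context (F : pmap R).
Context (hF : is_lorenz F) (eF : expandingI F).
Implicit Types (A E U : set R) (x y z p q : R) (n k l r : nat).
Local Notation c := (disc F).

(* If F(hi) < F(lo) then F is injective and misses a whole interval, in which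
   two points have a finite orbit that ends at c: one orbit contains the other. *)
Lemma lorenz_ends : F (lo F) <= F (hi F).
Proof.
rewrite leNgt; apply/negP => lt; have hc := lorenz_lt hF.
have side w : dom F w -> w != c ->
    (w < c /\ F (lo F) <= F w) \/ (c < w /\ F w <= F (hi F)).
  move=> /domP/andP[aw wb]; rewrite neq_lt => /orP[wc|cw]; [left|right]; split => //.
    move: aw; rewrite le_eqVlt => /orP[/eqP->//|aw]; apply: ltW.
    exact: (incL hF).
  move: wb; rewrite le_eqVlt => /orP[/eqP->//|wb]; apply: ltW.
  exact: (incR hF).
have inj w w' : dom F w -> dom F w' -> w != c -> w' != c -> F w = F w' -> w = w'.
  move=> dw dw' wc wc' e.
  have := side _ dw wc; have := side _ dw' wc'; rewrite e => s1 s2.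
  move: dw dw' => /domP hw /domP hw'.
  case: (ltgtP w w') => // h; exfalso; move: e.
    have [cc|cc] : (w' < c) \/ (c < w) by lra.
      by have := incL hF _ h cc; lra.
    by have := incR hF cc h; lra.
  have [cc|cc] : (w < c) \/ (c < w') by lra.
    by have := incL hF _ h cc; lra.
  by have := incR hF cc h; lra.
have iinj n w w' : dom F w -> dom F w' -> iter_def F n w -> iter_def F n w' ->
    iter n F w = iter n F w' -> w = w'.
  elim: n w w' => [//|n IH] w w' dw dw' /iter_defS[wc h] /iter_defS[wc' h'].
  by rewrite !iterSr => /IH e; apply: inj => //; apply: e => //; apply: lorenz_dom.
have one z1 z2 n1 n2 : F (hi F) < z1 < F (lo F) -> F (hi F) < z2 < F (lo F) ->
    dom F z1 -> dom F z2 -> iter_def F n1 z1 -> iter_def F n2 z2 ->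
    iter n1 F z1 = c -> iter n2 F z2 = c -> (n1 <= n2)%N -> z1 = z2.
  move=> hz1 hz2 d1 d2 h1 h2 e1 e2 n12.
  have [k e] : exists k, (n2 = k + n1)%N by exists (n2 - n1)%N; rewrite subnK.
  rewrite {n12}e in h2 e2.
  have e21 : iter k F z2 = z1.
    have [hk hk'] := (iter_defD _ _ _ _).1 h2.
    apply: (iinj n1) => //; first exact: iter_dom.
    by rewrite -iterD addnC e2 e1.
  case: k => [|k] in h2 e2 e21; first by rewrite -e21.
  have hk : iter_def F k.+1 z2 by apply: iter_def_le h2; rewrite leq_addr.
  have kc : iter k F z2 != c by apply: hk.
  (* Now [z1] is a value of [F], although [F] takes no value strictly between F(hi) and F(lo). *)
  have dk : dom F (iter k F z2) by apply: iter_dom => //; apply: iter_def_le hk.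
  by have := side _ dk kc; move: e21 => /= ->; lra.
have [h1 h2] := midf_lt lt; set m := (_ + _) / _ in h1 h2.
have dlo : dom F (F (lo F)).
  by apply: lorenz_dom => //; [apply/domP; lra|rewrite lt_eqF //; lra].
have dhi : dom F (F (hi F)).
  by apply: lorenz_dom => //; [apply/domP; lra|rewrite gt_eqF //; lra].
move: dlo dhi => /domP dlo /domP dhi.
have [|||z1 [n1 [hz1 k1 e1]]] := eF (x := F (hi F)) (y := m); try lra.
have [|||z2 [n2 [hz2 k2 e2]]] := eF (x := m) (y := F (lo F)); try lra.
have d1 : dom F z1 by apply/domP; lra.
have d2 : dom F z2 by apply/domP; lra.
have [n12|n21] := leqP n1 n2.
  by have := one z1 z2 n1 n2 ltac:(lra) ltac:(lra) d1 d2 k1 k2 e1 e2 n12; lra.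
by have := one z2 z1 n2 n1 ltac:(lra) ltac:(lra) d2 d1 k2 k1 e2 e1 (ltnW n21); lra.
Qed.

(** By [lorenz_ends] the images of the two branches cover the interior of the domain, and c is a
    preimage of both ends. Hence no f^{-n}(x) is empty, and alpha(x) is nonempty by compactness. *)
Lemma step_surj y : dom F y -> exists2 x, dom F x & step F x y.
Proof.
move=> /domP/andP[ay yb]; have hc := lorenz_lt hF; have he := lorenz_ends.
have dc := disc_dom hF.
move: ay; rewrite le_eqVlt => /orP[/eqP<-|ay].
  by exists c => //; split => //; right; split => //; left.
move: yb; rewrite le_eqVlt => /orP[/eqP->|yb].
  by exists c => //; split => //; right; split => //; right.
have [h|h] := leP (F (lo F)) y.
  have [z hz ez] := surjL hF (lexx _) (lorenz_lo hF) h yb.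
  have dz : dom F z by apply/domP; lra.
  by exists z => //; split => //; left; rewrite lt_eqF //; lra.
have [z hz ez] := surjR hF (lorenz_hi hF) (lexx _) ay (le_trans (ltW h) he).
have dz : dom F z by apply/domP; lra.
by exists z => //; split => //; left; rewrite gt_eqF //; lra.
Qed.

Lemma backward_ex n x : dom F x -> exists y, backward F n x y.
Proof.
move=> dx; elim: n => [|n [y hy]]; first by exists x.
by have [z _ s] := step_surj (backward_dom dx hy); exists z; apply/backwardS; exists y.
Qed.

Lemma alphaP x z : alpha F x z <-> forall n U, nbhs z U ->
  exists k y, [/\ (n <= k)%N, backward F k x y & U y].
Proof.
split=> [h n U hU|h n _ U hU].
  by have [y [[k nk hy] Uy]] := h n I U hU; exists k, y.
by have [k [y [nk hy Uy]]] := h n U hU; exists y; split => //; exists k.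
Qed.

Lemma closed_alpha x : closed (alpha F x).
Proof. by apply: closed_bigI => n _; exact: closed_closure. Qed.

Lemma closed_dom : closed (dom F).
Proof. exact: interval_closed. Qed.

Lemma alpha_dom x : dom F x -> alpha F x `<=` dom F.
Proof.
move=> dx z /(_ 0%N I) h; apply: closed_dom; apply: closure_subset h => y [k _].
exact: backward_dom.
Qed.

Lemma alpha_ex x : dom F x -> exists z, alpha F x z.
Proof.
move=> dx; have [u hu] := choice (fun n => @backward_ex n x dx).
have : compact (dom F) by exact: segment_compact.
move=> /(_ (u @ \oo) _) [].
  by exists 0%N => // n _; exact: backward_dom (hu n).
move=> z [_ hz]; exists z; apply/alphaP => n U hU.
have [||y [[k /= nk <-] Uy]] := hz [set y | exists2 k, (n <= k)%N & u k = y] U => //.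
  by exists n => // k /= nk; exists k.
by exists k, (u k).
Qed.

Lemma alpha_fwd x z : dom F x -> alpha F x z -> z != c -> alpha F x (F z).
Proof.
move=> dx hz zc; have dz := alpha_dom dx hz.
apply/alphaP => n U hU; have /cvg_withinP/(_ U hU) h := cvg_lorenz hF dz zc.
have zcn : \forall y \near z, y != c := near_neq zc.
(* Order n + 1 is requested because applying [F] lowers the order of a preimage by one. *)
have [k0 [y [nk hy [yc Uy]]]] := (alphaP _ _).1 hz n.+1 _ (filterI zcn h).
case: k0 nk hy => [//|k] nk hy.
exists k, (F y); split => //; last by apply: Uy; exact: backward_dom hy.
by apply: (@backward_iter_def _ F k 1 x y hy); apply/iter_defS.
Qed.

(** [F] is open at interior points other than c. At an endpoint of the domain only one side of the
    image is covered, hence the restriction in [qinv]. *)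
Lemma nbhs_branch z U : lo F < z < hi F -> z != c -> nbhs z U ->
  nbhs (F z) [set y | exists w, [/\ dom F w, w != c, U w & F w = y]].
Proof.
move=> hz zc hU; have hc := lorenz_lt hF.
have [x1 [x2 [h1 h2 h3 h4 h5]]] : exists x1 x2, [/\ lo F <= x1 /\ x2 <= hi F,
    x1 < z, z < x2, (x2 < c) || (c < x1) & forall w, x1 <= w <= x2 -> U w].
  move: zc; rewrite neq_lt => /orP[zc|cz].
    have [x1 [x2 [h1 h2 h3 h4 h5]]] := nbhs_sub_itv hU (a := lo F) (b := c) ltac:(lra).
    by exists x1, x2; split => //; [lra|rewrite h4].
  have [x1 [x2 [h1 h2 h3 h4 h5]]] := nbhs_sub_itv hU (a := c) (b := hi F) ltac:(lra).
  by exists x1, x2; split => //; [lra|rewrite h1 orbT].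
have mono x y : x1 <= x -> x < y -> y <= x2 -> F x < F y.
  by case/orP: h4 => h xx xy yx; [apply: (incL hF)|apply: (incR hF)] => //; lra.
have : nbhs (F z) `]F x1, F x2[%classic.
  by apply: near_in_itvoo; rewrite in_itv /= !mono // ltW.
apply: filterS => y /=; rewrite in_itv /= => hy.
have [|||||w hw ew] := @ivt _ _ hF x1 x2 y; try lra.
exists w; split => //; first by apply/domP; lra.
  by case/orP: h4 => h; [rewrite lt_eqF|rewrite gt_eqF] => //; lra.
exact: h5.
Qed.

Lemma alpha_back x z : dom F x -> lo F < z < hi F -> z != c ->
  alpha F x (F z) -> alpha F x z.
Proof.
move=> dx hz zc h; apply/alphaP => n U hU.
have [k [y [nk hy [w [dw wc Uw ew]]]]] := (alphaP _ _).1 h n _ (nbhs_branch hz zc hU).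
exists k.+1, w; split => //; first exact: leqW.
by apply/backwardS; exists y => //; split => //; left.
Qed.

(** Since f(c+) is [lo F], points close to [lo F] have preimages just to the right of c, and [lo F]
    itself has the preimage c. *)
Lemma alpha_lo x : dom F x -> alpha F x (lo F) -> alpha F x c.
Proof.
move=> dx h; apply/alphaP => n U hU; have hc := lorenz_lt hF.
have [x1 [x2 [h1 h2 h3 h4 h5]]] := nbhs_sub_itv hU (lorenz_lt hF).
have aF := gtR hF h3 (ltW h4).
have [k [y [nk hy yF]]] := (alphaP _ _).1 h n _ (lt_nbhsl aF).
have /domP/andP[ay yb] := backward_dom dx hy.
move: ay; rewrite le_eqVlt => /orP[/eqP ay|ay].
  exists k.+1, c; split; [exact: leqW| |by apply: h5; lra].
  apply/backwardS; exists y => //; rewrite -ay; split; first exact: disc_dom.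
  by right; split => //; left.
have [w hw ew] := surjR hF h3 (ltW h4) ay (ltW yF).
exists k.+1, w; split; [exact: leqW| |by apply: h5; lra].
apply/backwardS; exists y => //; split; first by apply/domP; lra.
by left; rewrite gt_eqF //; lra.
Qed.

Lemma alpha_hi x : dom F x -> alpha F x (hi F) -> alpha F x c.
Proof.
move=> dx h; apply/alphaP => n U hU; have hc := lorenz_lt hF.
have [x1 [x2 [h1 h2 h3 h4 h5]]] := nbhs_sub_itv hU (lorenz_lt hF).
have aF := ltL hF (ltW h1) h2.
have [k [y [nk hy yF]]] := (alphaP _ _).1 h n _ (lt_nbhsr aF).
have /domP/andP[ay yb] := backward_dom dx hy.
move: yb; rewrite le_eqVlt => /orP[/eqP yb|yb].
  exists k.+1, c; split; [exact: leqW| |by apply: h5; lra].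
  apply/backwardS; exists y => //; rewrite yb; split; first exact: disc_dom.
  by right; split => //; right.
have [w hw ew] := surjL hF (ltW h1) h2 (ltW yF) yb.
exists k.+1, w; split; [exact: leqW| |by apply: h5; lra].
apply/backwardS; exists y => //; split; first by apply/domP; lra.
by left; rewrite lt_eqF //; lra.
Qed.

(** Every interval contains a point whose orbit reaches c while staying inside the domain; pulling c
    back along it shows that the closed set alpha(x) is dense. *)
Lemma alpha_disc x : dom F x -> alpha F x c -> alpha F x = dom F.
Proof.
move=> dx hc; apply/seteqP; split; first exact: alpha_dom.
move=> z dz; apply: closed_alpha => U hU.
have [y1 [y2 [h1 h2 h3 h4]]] := dom_nbhs_itv (lorenz_lt hF) dz hU.
have [n [hn [w /= wU ew]]] := hit_ex eF h1 h2 h3 (U := `]y1, y2[%classic) (fun z h => h).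
exists w; split; last by apply: h4; move: wU; rewrite in_itv.
have inside k : (k <= n)%N -> lo F < iter k F w < hi F.
  move=> kn; move: wU; rewrite in_itv /= => /andP[u v].
  by apply: (iter_inside hF kn h1 u v h3) => t ht; apply: hn; rewrite /= in_itv.
have : iter_def F n w by exact: hn.
suff H k t : iter_def F k t -> (forall j, (j < k)%N -> lo F < iter j F t < hi F) ->
    alpha F x (iter k F t) -> alpha F x t.
  by move=> hw; apply: (H n) => //; [move=> j /ltnW /inside|rewrite ew].
elim: k t => [//|k IH] t /iter_defS[tc ht] h; rewrite iterSr => hk.
apply: alpha_back => //; first exact: (h 0%N).
by apply: IH => // j jk; rewrite -iterSr; apply: h.
Qed.

Lemma alpha_qinv x : dom F x -> ~ alpha F x c -> qinv F (alpha F x).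
Proof.
move=> dx nc; have ne z : alpha F x z -> z != c by move=> h; apply/eqP => e; rewrite e in h.
split => //; first exact: closed_alpha.
- exact: alpha_dom.
- by move=> z hz; apply: alpha_fwd => //; exact: ne.
- by move=> z hz zc; exact: alpha_back.
Qed.

Lemma alpha_inside x : dom F x -> ~ alpha F x c ->
  exists2 z, alpha F x z & lo F < z < hi F.
Proof.
move=> dx nc; have [z hz] := alpha_ex dx; exists z => //.
have /domP/andP[az zb] := alpha_dom dx hz.
rewrite !lt_neqAle az zb !andbT; apply/andP; split; apply/eqP => e; apply: nc.
  by apply: alpha_lo => //; rewrite e.
by apply: alpha_hi => //; rewrite -e.
Qed.

End Alpha.

(** * Renormalizations as return maps *)

Section ReturnMap.
Context {R : realType}.
Implicit Types (f g : pmap R) (A E U : set R) (x y z p q : R) (n k l r : nat).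

(* A renormalization in the wide sense: f itself is one, with l = r = 1. *)
Definition return_map f l r g :=
  [/\ (0 < l)%N /\ (0 < r)%N, dom g `<=` dom f /\ disc g = disc f,
    forall x, lo g <= x < disc f -> iter_def f l x /\ g x = iter l f x,
    forall x, disc f < x <= hi g -> iter_def f r x /\ g x = iter r f x
  & is_lorenz g].

Lemma return_map_id f : is_lorenz f -> return_map f 1 1 f.
Proof.
move=> hf; split => //; first by split.
  by move=> x /andP[u v]; split => //; apply/iter_defS; rewrite lt_eqF.
by move=> x /andP[u v]; split => //; apply/iter_defS; rewrite gt_eqF.
Qed.

Lemma renorm_return_map f l r g : renorm f l r g -> return_map f l r g.
Proof. by case=> -[l1 r1] [[h _] e] h1 h2 h3; split => //; split; exact: ltnW. Qed.

(* The number of iterations of f that amount to n iterations of g. *)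
Fixpoint time l r g n x : nat :=
  if n is n'.+1 then ((if (x < disc g)%R then l else r) + time l r g n' (g x))%N else 0%N.

(** With n < m, the point f^n(z) would be fixed by f^(m-n) along an orbit that avoids c, so no point
    of the interval would ever meet c. *)
Lemma coincide f n m x y : is_lorenz f -> expandingI f ->
  lo f <= x -> x < y -> y <= hi f ->
  (forall z, x < z < y -> [/\ iter_def f n z, iter_def f m z & iter n f z = iter m f z]) ->
  n = m.
Proof.
move=> hf ef ax xy yb.
wlog nm : n m / (n <= m)%N => [H|h].
  case: (leqP n m) => [|/ltnW] nm h; first exact: H.
  by apply/esym/H => // z /h[].
apply/eqP; rewrite eqn_leq nm leqNgt; apply/negP => lt.
pose k := (m - n)%N; have k0 : (0 < k)%N by rewrite subn_gt0.
have mk : m = (n + k)%N by rewrite subnKC.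
apply: (never_hits ef ax xy yb) => z N /h[h1 h2 e].
have /iter_defD[_ hk] : iter_def f (n + k) z by rewrite -mk.
have fixk : iter k f (iter n f z) = iter n f z by rewrite -iterD addnC -mk.
have per j : iter_def f (k * j) (iter n f z).
  elim: j => [|j IH]; first by rewrite muln0.
  by rewrite mulnS; apply/iter_defD; split => //; rewrite fixk.
have : iter_def f (n + k * N) z by apply/iter_defD.
by apply: iter_def_le; rewrite (leq_trans (leq_pmull N k0)) // leq_addl.
Qed.

Context (f g : pmap R) (l r : nat).
Context (hf : is_lorenz f) (ef : expandingI f) (hR : return_map f l r g).
Local Notation c := (disc f).

Lemma return_lorenz : is_lorenz g.
Proof. by case: hR. Qed.
Let hg := return_lorenz.

Lemma return_disc : disc g = c.
Proof. by case: hR => _ []. Qed.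

Lemma return_dom : dom g `<=` dom f.
Proof. by case: hR => _ []. Qed.

Lemma return_left x : lo g <= x < c -> iter_def f l x /\ g x = iter l f x.
Proof. by case: hR => _ _ h _ _; apply: h. Qed.

Lemma return_right x : c < x <= hi g -> iter_def f r x /\ g x = iter r f x.
Proof. by case: hR => _ _ _ h _; apply: h. Qed.

Lemma return_bounds : [/\ lo f <= lo g, lo g < c, c < hi g & hi g <= hi f].
Proof.
have := lorenz_lt hg; rewrite return_disc => h.
have /return_dom/domP : dom g (lo g) by apply/domP; lra.
have /return_dom/domP : dom g (hi g) by apply/domP; lra.
by move=> h1 h2; split; lra.
Qed.

Lemma return_time1 x : dom g x -> x != c ->
  iter_def f (if x < disc g then l else r) x /\
  g x = iter (if x < disc g then l else r) f x.
Proof.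
move=> /domP/andP[u v]; rewrite return_disc; case: ltgtP => // h _.
  by apply: return_left; rewrite u.
by apply: return_right; rewrite h.
Qed.

Lemma time_iter n x : dom g x -> iter_def g n x ->
  iter_def f (time l r g n x) x /\ iter n g x = iter (time l r g n x) f x.
Proof.
elim: n x => [//|n IH] x dx /iter_defS[xc hx].
have [h1 h2] := IH _ (lorenz_dom hg dx xc) hx.
have [k1 k2] := return_time1 dx ltac:(by rewrite -return_disc).
rewrite iterSr /= h2 addnC iterD -k2; split => //.
by rewrite addnC; apply/iter_defD; rewrite -k2.
Qed.

Lemma time_ge n x : (n <= time l r g n x)%N.
Proof.
elim: n x => [//|n IH] x /=; rewrite -add1n leq_add //.
by case: hR => -[l0 r0] _ _ _ _; case: ifP.
Qed.

Lemma time_const n x y : lo g <= x -> x <= y -> y <= hi g ->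
  (forall z, x <= z <= y -> iter_def g n z) -> time l r g n x = time l r g n y.
Proof.
elim: n x y => [//|n IH] x y ax xy yb h /=.
have [cxy h1 h2 h3 h4] := nohit_img hg ax xy yb h.
congr addn.
  case/orP: cxy => u; first by rewrite u (le_lt_trans xy).
  by rewrite !ltNge (ltW u) (ltW (lt_le_trans u xy)).
by apply: IH => // z /h4[w /h/iter_defS[_ hw] <-].
Qed.

(** During one step of [g] the f-orbit avoids c, so the first visit of f to c cannot be jumped over
    by a step of [g]. *)
Lemma return_expanding : expandingI g.
Proof.
have [b1 b2 b3 b4] := return_bounds.
move=> x y ax xy yb.
have [z [n [hz h1 h2]]] := ef (le_trans b1 ax) xy (le_trans yb b4).
have dz : dom g z by apply/domP; lra.
suff [k hk] : exists k, iter k g z = disc g.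
  by have [m [_ m1 m2]] := first_hit hk; exists z, m.
elim/ltn_ind: n z dz h1 h2 {hz} => n IH z dz h1 h2.
have [zc|zc] := eqVneq z c; first by exists 0%N; rewrite zc return_disc.
have [k1 k2] := return_time1 dz zc.
have kn := iter_def_hit h1 h2 k1.
set k := if _ then _ else _ in k1 k2 kn.
have k0 : (0 < k)%N by rewrite /k; case: hR => -[l0 r0] _ _ _ _; case: ifP.
have /iter_defD[_ h3] : iter_def f (k + (n - k)) z by rewrite subnKC.
have [||||m hm] := IH (n - k)%N _ (g z).
- by rewrite ltn_subrL k0 (leq_trans k0).
- by apply: lorenz_dom hg _ dz _; rewrite return_disc.
- by rewrite k2.
- by rewrite k2 -iterD subnK.
by exists m.+1; rewrite iterSr.
Qed.

Lemma return_hi : hi g = iter l (left_map f) c.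
Proof.
have h1 := cvgL hg; rewrite return_disc in h1.
have h2 := @cvg_left_value _ _ hf l.
apply: (cvg_unique _ h1 _) => //; apply: cvg_trans h2; apply: near_eq_cvg.
have [b1 b2 b3 b4] := return_bounds.
near=> x; have [|_ ->//] := @return_left x.
by apply/andP; split; [apply: ltW|]; near: x; [exact: nbhs_left_gt|exact: nbhs_left_lt].
Unshelve. all: by end_near. Qed.

Lemma return_lo : lo g = iter r (right_map f) c.
Proof.
have h1 := cvgR hg; rewrite return_disc in h1.
have h2 := @cvg_right_value _ _ hf r.
apply: (cvg_unique _ h1 _) => //; apply: cvg_trans h2; apply: near_eq_cvg.
have [b1 b2 b3 b4] := return_bounds.
near=> x; have [|_ ->//] := @return_right x.
by apply/andP; split; [|apply: ltW]; near: x; [exact: nbhs_right_gt|exact: nbhs_right_lt].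
Unshelve. all: by end_near. Qed.

Lemma return_backward_lo : backward f r (lo g) c.
Proof. rewrite return_lo; exact: backward_right. Qed.

Lemma return_backward_hi : backward f l (hi g) c.
Proof. rewrite return_hi; exact: backward_left. Qed.

Lemma return_step z y : step g z y -> exists2 k, (0 < k)%N & backward f k y z.
Proof.
case: (hR) => -[l0 r0] _ _ _ _ [dz [[zc ->]|[-> [->|->]]]]; rewrite ?return_disc.
- rewrite return_disc in zc; have [h1 h2] := return_time1 dz zc.
  exists (if z < disc g then l else r); first by case: ifP.
  by apply: backward_iter => //; exact: return_dom.
- by exists r => //; exact: return_backward_lo.
- by exists l => //; exact: return_backward_hi.
Qed.

Lemma return_backward n y z : backward g n y z ->
  exists2 k, (n <= k)%N & backward f k y z.
Proof.
elim: n z => [|n IH] z; first by move=> ->; exists 0%N.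
move=> /backwardS[w /IH[k nk hk] /return_step[j j0 hj]].
by exists (j + k)%N; [rewrite -add1n leq_add|exact: backwardD hk hj].
Qed.

(** A [g]-preimage of order n is an f-preimage of order at least n, so accumulation along [g] is
    accumulation along f. *)
Lemma return_alpha k x y : backward f k x y -> alpha g y `<=` alpha f x.
Proof.
move=> hy z hz; apply/alphaP => n U hU.
have [m [w [nm hw Uw]]] := (alphaP _ _ _).1 hz n _ hU.
have [j mj hj] := return_backward hw.
exists (j + k)%N, w; split => //; last exact: backwardD hy hj.
by rewrite (leq_trans nm) // (leq_trans mj) // leq_addr.
Qed.

(** Transfers an invariant set of f to [g], where the minimality hypothesis can be used. *)
Lemma return_qinv A : qinv f A -> qinv g (A `&` dom g).
Proof.
move=> hA; have [cA dA nA fA bA] := hA; have [b1 b2 b3 b4] := return_bounds.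
have ne x : A x -> x != c by move=> Ax; apply/eqP => e; rewrite e in Ax.
split.
- by apply: closedI => //; exact: closed_dom.
- by move=> x [].
- by rewrite return_disc => -[].
- move=> x [Ax dx]; split.
    by have [_ ->] := return_time1 dx (ne _ Ax); exact: qinv_iter.
  by apply: lorenz_dom hg _ dx _; rewrite return_disc; exact: ne.
- move=> x hx xc [Agx _]; have dx : dom g x by apply/domP; lra.
  split => //; move: Agx; rewrite return_disc in xc.
  move: (xc); rewrite neq_lt => /orP[xlt|xgt].
    have [_ ->] := return_left (x := x) ltac:(lra).
    apply: (qinv_open_back hf hA (x := lo g) (y := c)) => //; try lra.
    by move=> w hw; have [] := return_left (x := w) ltac:(lra).
  have [_ ->] := return_right (x := x) ltac:(lra).
  apply: (qinv_open_back hf hA (x := c) (y := hi g)) => //; try lra.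
  by move=> w hw; have [] := return_right (x := w) ltac:(lra).
Qed.

End ReturnMap.

(** * Entrance of orbits into gaps and renormalization intervals *)

Section Enter.
Context {R : realType}.
Context (F : pmap R).
Context (hF : is_lorenz F) (eF : expandingI F).
Implicit Types (A E U : set R) (x y z p q : R) (n k l r : nat).
Local Notation c := (disc F).

(** Adds backward invariance at [lo F] and [hi F], so that the endpoints of the domain, too, can be
    followed into the gap. *)
Definition cinv E := qinv F E /\ forall x, dom F x -> x != c -> E (F x) -> E x.

Lemma cinv_iter_back E n x : cinv E -> dom F x -> iter_def F n x ->
  E (iter n F x) -> E x.
Proof.
move=> [hE bE]; elim: n x => [//|n IH] x dx /iter_defS[xc hx].
by rewrite iterSr => /IH h; apply: bE => //; apply: h => //; apply: lorenz_dom.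
Qed.

(** Take a neighbourhood [W] of [z] that misses [E], and the first time at which some point of [W]
    is at c. The image of [W] at that time is an interval through c that misses [E], hence lies in
    ]p, q[. *)
Lemma cinv_enter E p q z : cinv E -> left_gap F E p -> right_gap F E q ->
  dom F z -> ~ E z -> exists2 k, iter_def F k z & p < iter k F z < q.
Proof.
move=> hE [Ep pc _] [Eq cq _] dz nEz; have [[cE _ _ _ _] bE] := hE.
have : nbhs z (~` E) by apply: open_nbhs_nbhs; split => //; exact: closed_openC.
move=> /nbhs_itvP[e e0 he].
have [|y1 [y2 [h1 h2 h3 h4]]] := dom_nbhs_itv (lorenz_lt hF) dz (U := `]z - e, z + e[%classic).
  by apply: near_in_itvoo; rewrite in_itv /=; lra.
pose W := [set w | dom F w /\ z - e < w < z + e].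
have [|n [hn [w0 [dw0 w0e] ew0]]] := hit_ex eF h1 h2 h3 (U := W).
  move=> w hw; split; first by apply/domP; lra.
  by have := h4 _ hw; rewrite /= in_itv.
have nW w : W w -> ~ E (iter n F w).
  by move=> hw hEw; apply: (he w); [case: hw|apply: (cinv_iter_back hE) hEw; [case: hw|exact: hn]].
have cW x y w : W x -> W y -> x <= w <= y -> W w.
  move=> [/domP dx hx] [/domP dy hy] hw; split; last lra.
  by apply/domP; lra.
have Wz : W z by split => //; lra.
have Ww0 : W w0 by [].
exists n; first exact: hn.
move: dz dw0 => /domP /andP[az zb] /domP /andP[aw0 w0b].
rewrite !ltNge; apply/andP; split; apply/negP => le.
  have zw0 : z <= w0.
    rewrite leNgt; apply/negP => lt.
    have := iter_mono hF (n := n) aw0 lt zb.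
    rewrite ew0 => h; have : c < iter n F z; last lra.
    by apply: h => w hw; apply: hn; exact: cW hw.
  have [||w hw ew] := @iter_ivt _ _ hF n z w0 p az zw0 w0b.
  - by move=> w hw; apply: hn; exact: cW hw.
  - by rewrite le ew0 ltW.
  by apply: (nW w); [exact: cW hw|rewrite ew].
have zw0 : w0 <= z.
  rewrite leNgt; apply/negP => lt.
  have := iter_mono hF (n := n) az lt w0b.
  rewrite ew0 => h; have : iter n F z < c; last lra.
  by apply: h => w hw; apply: hn; exact: cW hw.
have [||w hw ew] := @iter_ivt _ _ hF n w0 z q aw0 zw0 zb.
- by move=> w hw; apply: hn; exact: cW hw.
- by rewrite le ew0 ltW.
by apply: (nW w); [exact: cW hw|rewrite ew].
Qed.

(** f^l pushes [z] to the right. If its f^l-orbit never crossed c, the orbits of all points of ]p,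
    z[ would be held below it and never meet c. The crossing step starts to the left of c, so it
    lands below f^l(c-). *)
Lemma gap_enter_left A p l z : qinv F A -> left_gap F A p -> lo F < p ->
  hit F `]p, c[%classic l -> p < z < c ->
  exists2 n, iter_def F n z & c <= iter n F z < iter l (left_map F) c.
Proof.
move=> hA gp ap hl pzc; have hc := lorenz_lt hF.
have up := renewal_up hF eF hA gp ap hl.
have def := renewal_def hA gp hl.
pose G := iter l F.
have H n y : p < y < c -> (forall j, (j < n)%N -> iter j G y < c) ->
    iter_def F (n * l) y /\ p < iter n G y.
  elim: n => [|n IH] hy ltc; first by split => //=; lra.
  have [j jn|IH1 IH2] := IH hy; first by apply: ltc; rewrite ltnS ltnW.
  have ltn := ltc n (ltnSn n).
  rewrite mulSn addnC iter_defD iterM -/G; split.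
    by split => //; apply: def; rewrite ltW.
  by rewrite iterS; apply: (lt_trans IH2); apply: up; rewrite IH2.
have [[n hn]|no] := pselect (exists n, c <= iter n G z); last first.
  have lt n : iter n G z < c by rewrite ltNge; apply/negP => h; apply: no; exists n.
  exfalso; apply: (@never_hits _ _ eF p z); try lra.
  move=> y k hy.
  have ltyz n : iter n G y < iter n G z.
    elim/ltn_ind: n => -[_|n IH]; first by case/andP: hy.
    rewrite !iterS; apply: (renewal_mono hF hA gp ap hl) => //; last exact: IH.
    have [||_ h] := H n y; [lra| |exact: ltW].
    by move=> j jn; apply: lt_trans (lt j); apply: IH; rewrite ltnS ltnW.
  have [||h _] := H k y; first lra.
    by move=> j _; apply: lt_trans (ltyz j) (lt j).
  apply: iter_def_le h; rewrite -{1}[k]muln1 leq_mul //.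
  exact: ltnW (renewal_gt1 hF eF hA gp ap hl).
have ex : exists n, c <= iter n G z by exists n.
case: (ex_minnP ex) => [[|m]] hm min; first by move: hm => /=; lra.
have ltm j : (j < m.+1)%N -> iter j G z < c.
  by move=> jm; rewrite ltNge; apply/negP => /min; rewrite leqNgt jm.
exists (m.+1 * l)%N; first by have [] := H m.+1 z pzc ltm.
rewrite iterM -/G hm iterS /=; apply: (renewal_lt_left hF hA gp ap hl).
have [|_ h] := H m z pzc; first by move=> j jm; apply: ltm; rewrite ltnS ltnW.
by rewrite ltW //= ltm.
Qed.

End Enter.

Section EnterRight.
Context {R : realType}.
Context (F : pmap R).
Context (hF : is_lorenz F) (eF : expandingI F).
Local Notation c := (disc F).

Lemma gap_enter_right A q r z : qinv F A -> right_gap F A q -> q < hi F ->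
  hit F `]c, q[%classic r -> c < z < q ->
  exists2 n, iter_def F n z & iter r (right_map F) c < iter n F z <= c.
Proof.
move=> hA gq qb hr cz.
have [||||n /iter_def_flip hn] := @gap_enter_left _ _ (lorenz_flip hF)
  (expandingI_flip eF) (mirror A) (- q) r (- z) (qinv_flip hA).
- exact/gap_flip.
- by rewrite /= ltrN2.
- by rewrite /= -mirror_itv -hit_flip.
- by rewrite /=; lra.
rewrite opprK in hn; rewrite iter_flip opprK => h; exists n => //.
by rewrite iter_right_map; move: h => /=; lra.
Qed.

End EnterRight.

(** * The invariant set of a renormalization *)

Section Associated.
Context {R : realType}.
Implicit Types (f g h : pmap R) (A E U : set R) (x y z p q : R) (n k l r : nat).

Lemma hit_timeP f U n : is_lorenz f -> U `<=` dom f -> hit_time f U n -> hit f U n.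
Proof.
move=> hf Ud [[w [Uw hw]] min].
have none k v : (k < n)%N -> U v -> ~ backward f k (disc f) v.
  by move=> kn Uv hv; have : (U `&` backward f k (disc f)) v by []; rewrite min.
split.
  move=> v Uv j jn; apply/eqP => /first_hit[k [kj h1 h2]].
  apply: (none k v) => //; first exact: leq_ltn_trans jn.
  by apply: backward_iter => //; exact: Ud.
have [k [kn h1 h2]] := backward_hit hw; exists w => //.
case: (ltnP k n) => [lt|nk]; last by have /eqP <- : k == n by rewrite eqn_leq kn.
by case: (none k w) => //; apply: backward_iter => //; exact: Ud.
Qed.

(* The data attached to the renormalization h of f by the set E: the critical
   gap ]p, q[ of E and the return times l and r. *)
Record assoc f E h p q l r : Prop := Assoc {
  assoc_cinv : cinv f E;
  assoc_step : forall x y, E y -> step f x y -> E x;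
  assoc_inside : forall x, E x -> lo f < x < hi f;
  assoc_left : left_gap f E p;
  assoc_right : right_gap f E q;
  assoc_hit_left : hit f `]p, disc f[%classic l;
  assoc_hit_right : hit f `]disc f, q[%classic r;
  assoc_return : return_map f l r h }.

(** If c were in [E], so would be all its preimages, and the closed set [E] would be the whole
    domain. As c is a preimage of both endpoints of the domain, these are not in [E] either. *)
Lemma associatedP f E h : is_lorenz f -> expandingI f -> is_lorenz h ->
  dom h `<=` dom f -> associated f E h ->
  exists p q l r, assoc f E h p q l r.
Proof.
move=> hf ef hh dhf [[e Ee] cE [_ nE] [dE fE bE] [l [r [[hl hr] edisc _ hL hR]]]].
have hc := lorenz_lt hf.
have stepE x y : E y -> step f x y -> E x by move=> Ey s; rewrite -bE; exists y.
have nc : ~ E (disc f).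
  move=> Ec; apply: nE => x dx; apply: cE.
  have /(_ x dx) := (expandingP hf).2 ef.
  apply: closure_subset => y [n _]; elim: n y => [y ->//|n IH] y /backwardS[z hz].
  exact/stepE/IH.
have nlo : ~ E (lo f).
  move=> h0; apply: nc; apply: stepE h0 _; split; first exact: disc_dom.
  by right; split => //; left.
have nhi : ~ E (hi f).
  move=> h0; apply: nc; apply: stepE h0 _; split; first exact: disc_dom.
  by right; split => //; right.
have ins x : E x -> lo f < x < hi f.
  move=> Ex; have /domP/andP[ax xb] := dE _ Ex.
  by rewrite !lt_neqAle ax xb !andbT; apply/andP; split; apply/eqP => h0;
    [apply: nlo; rewrite h0|apply: nhi; rewrite -h0].
have cinvE : cinv f E.
  split; last by move=> x dx xc /stepE; apply; split => //; left.
  split => //.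
    move=> x Ex; rewrite -fE; exists x => //; split; first exact: dE.
    by left; split => //; apply/eqP => h0; apply: nc; rewrite -h0.
  by move=> x hx xc /stepE; apply; split; [apply/domP; lra|left].
have [p [q [_ [_ [gp gq hp hq _]]]]] := qinv_gaps hf ef cinvE.1 Ee (ins _ Ee).
rewrite (e_minusE gp) in hl; rewrite (e_plusE gq) in hr.
have {}hl : hit f `]p, disc f[%classic l.
  by apply: hit_timeP hl => // x; rewrite /= in_itv /= => hx; apply/domP; lra.
have {}hr : hit f `]disc f, q[%classic r.
  by apply: hit_timeP hr => // x; rewrite /= in_itv /= => hx; apply/domP; lra.
exists p, q, l, r; split => //; split => //.
have ap : lo f < p by lra.
have qb : q < hi f by lra.
split; first exact: (ltnW (renewal_gt1 hf ef cinvE.1 gp ap hl)).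
exact: (ltnW (renewal_gt1_right hf ef cinvE.1 gq qb hr)).
Qed.

End Associated.

Section Assoc.
Context {R : realType}.
Context (f h : pmap R) (E : set R) (p q : R) (l r : nat).
Context (hf : is_lorenz f) (ef : expandingI f) (ha : assoc f E h p q l r).
Implicit Types (A U : set R) (x y z : R) (n k : nat).
Local Notation c := (disc f).

Lemma assoc_qinv : qinv f E.
Proof. by case: ha => -[]. Qed.

Lemma assoc_bounds : [/\ lo f < p, p < c, c < q & q < hi f].
Proof.
have [Ep pc _] := assoc_left ha; have [Eq cq _] := assoc_right ha.
have := assoc_inside ha Ep; have := assoc_inside ha Eq.
by move=> h1 h2; split; lra.
Qed.

Lemma assoc_gap x : E x -> ~ (p < x < q).
Proof.
move=> Ex hx; have [_ _ maxp] := assoc_left ha; have [_ _ minq] := assoc_right ha.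
have [_ _ nc _ _] := assoc_qinv.
case: (ltgtP x c) => xc; last by rewrite xc in Ex.
  by have := maxp _ Ex xc; lra.
by have := minq _ Ex xc; lra.
Qed.

Lemma assoc_backward n x y : E x -> backward f n x y -> E y.
Proof.
move=> Ex; elim: n y => [y ->//|n IH] y /backwardS[z /IH hz].
exact: assoc_step ha _ _ hz.
Qed.

(** The endpoint is f^r'(c+), so c is among its preimages, while [E] contains all preimages of its
    points. *)
Lemma assoc_notin_lo (g : pmap R) l' r' : return_map f l' r' g -> ~ E (lo g).
Proof.
move=> hR /assoc_backward/(_ (return_backward_lo hf hR)).
by have [_ _ nc _ _] := assoc_qinv.
Qed.

Lemma assoc_notin_hi (g : pmap R) l' r' : return_map f l' r' g -> ~ E (hi g).
Proof.
move=> hR /assoc_backward/(_ (return_backward_hi hf hR)).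
by have [_ _ nc _ _] := assoc_qinv.
Qed.

(** The interval of [h] lies in [p, q], and its endpoints are not in [E]. *)
Lemma assoc_disjoint x : E x -> ~ dom h x.
Proof.
move=> Ex /domP hx; have hR := assoc_return ha.
have [b1 b2 b3 b4] := assoc_bounds.
have v := renewal_left_le hf assoc_qinv (assoc_left ha) b1 (assoc_hit_left ha) (assoc_right ha).
have u := renewal_right_ge hf assoc_qinv (assoc_right ha) b4 (assoc_hit_right ha) (assoc_left ha).
rewrite -(return_hi hf hR) in v; rewrite -(return_lo hf hR) in u.
have nlo := assoc_notin_lo hR; have nhi := assoc_notin_hi hR.
apply: (assoc_gap Ex); apply/andP; split.
  rewrite lt_neqAle; apply/andP; split; last lra.
  apply/eqP => e; apply: nlo; rewrite (_ : lo h = x) //; lra.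
rewrite lt_neqAle; apply/andP; split; last lra.
by apply/eqP => e; apply: nhi; rewrite (_ : hi h = x) //; lra.
Qed.

(** The inequalities are strict so that points close to [z] enter the interval at the same time. *)
Lemma assoc_enter z : dom f z -> ~ E z ->
  exists2 k, iter_def f k z & lo h < iter k f z < hi h.
Proof.
move=> dz nE; have hR := assoc_return ha; have [b1 b2 b3 b4] := assoc_bounds.
have [r1 r2 r3 r4] := return_bounds hR.
have [k hk hpq] := cinv_enter hf ef (assoc_cinv ha) (assoc_left ha) (assoc_right ha) dz nE.
case: (ltgtP (iter k f z) c) => zc; last by exists k => //; rewrite zc r2.
  have [|n hn] := gap_enter_left hf ef assoc_qinv (assoc_left ha) b1 (assoc_hit_left ha)
    (z := iter k f z); first by lra.
  rewrite -(return_hi hf hR) -iterD addnC => hi_; exists (k + n)%N; last lra.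
  exact/iter_defD.
have [|n hn] := gap_enter_right hf ef assoc_qinv (assoc_right ha) b4 (assoc_hit_right ha)
  (z := iter k f z); first by lra.
rewrite -(return_lo hf hR) -iterD addnC => lo_; exists (k + n)%N; last lra.
exact/iter_defD.
Qed.

(** A point of alpha(x) outside [E] enters the interval of [h] after [k] steps, and so does a nearby
    preimage of [x] of order at least [k]; then [x] is in the orbit of the interval. *)
Lemma alpha_outside_orb x : dom f x -> ~ orb f (dom h) x -> alpha f x `<=` E.
Proof.
move=> dx norb z hz; apply: contrapT => nEz.
have dz := alpha_dom dx hz.
have [k hk kz] := assoc_enter dz nEz.
have [/cvg_withinP h1 h2] := near_iter hf dz hk.
have /h1 h3 : nbhs (iter k f z) `]lo h, hi h[%classic.
  by apply: near_in_itvoo; rewrite in_itv.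
have [m [y [km hy [hy1 hy2]]]] := (alphaP _ _ _).1 hz k _ (filterI h2 h3).
have dy := backward_dom dx hy.
apply: norb; apply/orbP; exists (m - k)%N, (iter k f y).
  by have := hy2 dy; rewrite /= in_itv /= => hi_; apply/domP; lra.
by apply: backward_iter_def (hy1 dy); rewrite subnKC.
Qed.

End Assoc.

(** * Minimal renormalizations *)

Section Minimal.
Context {R : realType}.
Implicit Types (f g h : pmap R) (A B C E U : set R) (x y z p q u v : R) (n k l r : nat).

Lemma return_map_flip f l r g : return_map f l r g -> return_map (flip f) r l (flip g).
Proof.
move=> hR; have [[l0 r0] [d e] h1 h2 hg] := hR; split => //.
- by split; [move=> x /dom_flip/d dx; apply/dom_flip|rewrite /= e].
- move=> x /= hx; have [|k1 k2] := h2 (- x); first lra.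
  by rewrite iter_flip k2; split => //; apply/iter_def_flip.
- move=> x /= hx; have [|k1 k2] := h1 (- x); first lra.
  by rewrite iter_flip k2; split => //; apply/iter_def_flip.
- exact: lorenz_flip.
Qed.

(* The number of g-steps up to the first hit of c from ]p, c[ is the l' for which
   g^l' = f^m near c-, because f^m is the first hit of c by f. *)
Lemma hit_time_return f g l r p l2 m l' u :
  is_lorenz f -> expandingI f -> return_map f l r g ->
  lo g <= p -> p < disc g ->
  hit g `]p, disc g[%classic l2 -> hit f `]p, disc f[%classic m ->
  lo g <= u -> u < disc g ->
  (forall x, u <= x < disc g -> iter_def g l' x /\ iter m f x = iter l' g x) ->
  l2 = l'.
Proof.
move=> hf ef hR ap pc [h2 [w2 w2p e2]] [hm [w wp e]] au uc hu.
have hg := return_lorenz hR; have eg := return_expanding ef hR.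
have ec := return_disc hR; have hc := lorenz_lt hg.
have dg x : `]p, disc g[%classic x -> dom g x.
  by rewrite /= in_itv /= => hx; apply/domP; lra.
have tc x y : `]p, disc g[%classic x -> `]p, disc g[%classic y -> time l r g l2 x = time l r g l2 y.
  wlog xy : x y / x <= y => [H|].
    by move=> hx hy; case: (leP x y) => [|/ltW] xy; [exact: H|apply/esym/H].
  rewrite /= !in_itv /= => hx hy; apply: (time_const hR) => //; try lra.
  by move=> z hz; apply: h2; rewrite /= in_itv /=; lra.
have t2 x : `]p, disc g[%classic x ->
    iter_def f (time l r g l2 x) x /\ iter l2 g x = iter (time l r g l2 x) f x.
  by move=> hx; apply: (time_iter hR); [exact: dg|exact: h2].
rewrite -ec in wp hm.
have tm : time l r g l2 w = m.
  apply/eqP; rewrite eqn_leq; apply/andP; split.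
    by apply: (iter_def_hit (hm _ wp) e); case: (t2 _ wp).
  rewrite (tc _ _ wp w2p); apply: (@iter_def_hit _ f _ w2); [by case: (t2 _ w2p)| |exact: hm].
  by have [_ <-] := t2 _ w2p; rewrite e2.
have [x0 [hx0 hx0p hx0u]] : exists x0, [/\ x0 < disc g, p <= x0 & u <= x0].
  by case: (leP p u) => h; [exists u|exists p]; split => //; exact: ltW.
apply: (coincide hg eg (x := x0) (y := disc g)) => //; try lra.
move=> x hx; have xp : `]p, disc g[%classic x by rewrite /= in_itv /=; lra.
have [|k1 k2] := hu x; first lra.
split => //; first exact: h2.
by have [_ ->] := t2 _ xp; rewrite (tc _ _ xp wp) tm k2.
Qed.

(** The gap of [C] is the smaller one, so l1 <= l2; also l2 = l' by [hit_time_return] and l' <= l1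
    by minimality. With equal times, g^l2 fixes both [p1] and [p], and would trap the interval
    between them. *)
Lemma gap_left_eq f g l r B C p1 p l1 l2 m l' u :
  is_lorenz f -> expandingI f -> return_map f l r g ->
  qinv g B -> qinv g C -> B `<=` C ->
  left_gap g B p1 -> lo g < p1 -> left_gap g C p ->
  hit g `]p1, disc g[%classic l1 -> hit g `]p, disc g[%classic l2 ->
  hit f `]p, disc f[%classic m ->
  lo g <= u -> u < disc g ->
  (forall x, u <= x < disc g -> iter_def g l' x /\ iter m f x = iter l' g x) ->
  (l' <= l1)%N -> p1 = p.
Proof.
move=> hf ef hR hB hC BC gB ap1 gC h1 h2 hm au uc hu l'1.
have hg := return_lorenz hR; have eg := return_expanding ef hR.
have [B1 p1c max1] := gB; have [C1 pc max] := gC.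
have p1p : p1 <= p by apply: max => //; exact: BC.
have ap : lo g < p by lra.
have l2' := hit_time_return hf ef hR (ltW ap) pc h2 hm au uc hu.
have [w2 w2p e2] := h2.2.
have l12 : (l1 <= l2)%N.
  apply: (iter_def_hit (h2.1 _ w2p) e2); apply: h1.1.
  by move: w2p; rewrite /= !in_itv /=; lra.
have el : l1 = l2 by apply/eqP; rewrite eqn_leq l12 l2'.
subst l1; apply/eqP; rewrite eq_le p1p leNgt; apply/negP => lt.
have hc := lorenz_lt hg.
apply: (@no_trapped_itv _ _ eg l2 p1 p) => //; try lra.
  exact: ltnW (renewal_gt1 hg eg hB gB ap1 h1).
move=> z hz; split; first by apply: h1.1; rewrite /= in_itv /=; lra.
apply/andP; split.
  rewrite -[X in X < _](renewal_fix hg hB gB ap1 h1).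
  by apply: (renewal_mono hg hB gB ap1 h1); lra.
rewrite -[X in _ < X](renewal_fix hg hC gC ap h2).
by apply: (renewal_mono hg hB gB ap1 h1); lra.
Qed.

Lemma gap_right_eq f g l r B C q1 q r1 r2 m r' v :
  is_lorenz f -> expandingI f -> return_map f l r g ->
  qinv g B -> qinv g C -> B `<=` C ->
  right_gap g B q1 -> q1 < hi g -> right_gap g C q ->
  hit g `]disc g, q1[%classic r1 -> hit g `]disc g, q[%classic r2 ->
  hit f `]disc f, q[%classic m ->
  v <= hi g -> disc g < v ->
  (forall x, disc g < x <= v -> iter_def g r' x /\ iter m f x = iter r' g x) ->
  (r' <= r1)%N -> q1 = q.
Proof.
move=> hf ef hR hB hC BC gB qb1 gC h1 h2 hm vb cv hv r'1.
apply: oppr_inj; apply: (gap_left_eq (l1 := r1) (l2 := r2) (m := m) (l' := r') (u := - v)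
  (lorenz_flip hf) (expandingI_flip ef)
  (return_map_flip hR) (qinv_flip hB) (qinv_flip hC)) => //=.
- by move=> x; exact: BC.
- exact/gap_flip.
- by rewrite ltrN2.
- exact/gap_flip.
- by rewrite -mirror_itv -hit_flip.
- by rewrite -mirror_itv -hit_flip.
- by rewrite -mirror_itv -hit_flip.
- by rewrite lerN2.
- by rewrite ltrN2.
- move=> x hx; have [|k1 k2] := hv (- x); first lra.
  by rewrite !iter_flip k2; split => //; apply/iter_def_flip.
Qed.

(** The trace of [A] on [dom g] defines a renormalization of [g], to which minimality applies; this
    gives [A] the gap ]p, q[ of [E]. A point of [E] outside [A] would then enter ]p, q[, whereas its
    orbit stays in [E]. *)
Lemma minimal_inside f g h l r l' r' E p q m m' A x :
  is_lorenz f -> expandingI f -> return_map f l r g ->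
  renorm g l' r' h ->
  (forall l1 r1 G, renorm g l1 r1 G -> (l' <= l1)%N /\ (r' <= r1)%N) ->
  assoc f E h p q m m' ->
  qinv f A -> A `<=` E -> A x -> dom g x -> A = E.
Proof.
move=> hf ef hR hr min ha hA AE Ax dx.
have hg := return_lorenz hR; have eg := return_expanding ef hR.
have ec := return_disc hR; have hc := lorenz_lt hg.
have hB := return_qinv hf hR hA; have hC := return_qinv hf hR (assoc_qinv ha).
have xin : lo g < x < hi g.
  move: (dx) => /domP/andP[u v]; rewrite !lt_neqAle u v !andbT.
  apply/andP; split; apply/eqP => e.
    by apply: (assoc_notin_lo hf ha hR); rewrite e; exact: AE.
  by apply: (assoc_notin_hi hf ha hR); rewrite -e; exact: AE.
have [p1 [q1 [l1 [r1 [gp1 gq1 hp1 hq1 [hl1 hr1]]]]]] := qinv_gaps hg eg hB (conj Ax dx) xin.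
have [p2 [q2 [l2 [r2 [gp2 gq2 hp2 hq2 [hl2 hr2]]]]]] :=
  qinv_gaps hg eg hC (conj (AE _ Ax) dx) xin.
have ap1 : lo g < p1 by lra.
have qb1 : q1 < hi g by lra.
have [G hG] := gaps_renorm hg eg hB gp1 gq1 ap1 qb1 hl1 hr1.
have [ml mr] := min _ _ _ hG.
have gl := assoc_left ha; have gr := assoc_right ha.
have [Ep pc maxp] := gl; have [Eq cq minq] := gr.
(* [p] is at least as close to c as [p2], a point of [dom g]; so it lies in [dom g] and the trace of
   [E] has the gap of [E]. *)
have ep : p2 = p.
  have [[Ep2 _] p2c _] := gp2; have := maxp _ Ep2; rewrite -ec => /(_ p2c) p2p.
  apply: (left_gap_unique (F := g) gp2 (B := E)) => //.
    by split => //; rewrite ec.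
  by split => //; apply/domP; lra.
have eq_ : q2 = q.
  have [[Eq2 _] q2c _] := gq2; have := minq _ Eq2; rewrite -ec => /(_ q2c) q2q.
  apply: (right_gap_unique (F := g) gq2 (B := E)) => //.
    by split => //; rewrite ec.
  by split => //; apply/domP; lra.
subst p2 q2.
have BC : A `&` dom g `<=` E `&` dom g by move=> y [/AE Ey dy].
have hR2 := assoc_return ha; have hR' := renorm_return_map hr.
have [b1 b2 b3 b4] := return_bounds hR'.
have e1 : p1 = p.
  apply: (gap_left_eq hf ef hR hB hC BC gp1 ap1 gp2 hl1 hl2 (assoc_hit_left ha) b1 b2 _ ml).
  move=> y hy; have [k1 k2] := return_left hR' hy.
  by rewrite ec in hy; have [_ <-] := return_left hR2 hy.
have e2 : q1 = q.
  apply: (gap_right_eq hf ef hR hB hC BC gq1 qb1 gq2 hr1 hr2 (assoc_hit_right ha) b4 b3 _ mr).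
  move=> y hy; have [k1 k2] := return_right hR' hy.
  by rewrite ec in hy; have [_ <-] := return_right hR2 hy.
subst p1 q1.
have glA : left_gap f A p.
  by split => //; [case: gp1 => -[]|move=> y /AE; exact: maxp].
have grA : right_gap f A q.
  by split => //; [case: gq1 => -[]|move=> y /AE; exact: minq].
apply/seteqP; split => // z Ez; apply: contrapT => nAz.
(* A preimage of a point of [A] is in [E], hence is not an endpoint of the domain, and [qinv]
   applies to it. *)
have cA : cinv f A.
  split => // y dy yc Ay; case: (hA) => _ _ _ _; apply => //.
  by apply: (assoc_inside ha); apply: (assoc_cinv ha).2 => //; exact: AE.
have /andP[/ltW az /ltW zb] := assoc_inside ha Ez.
have [|k _] := cinv_enter hf ef cA glA grA _ nAz; first by apply/domP; rewrite az.
by apply: (assoc_gap ha); apply: (qinv_iter _ (assoc_qinv ha)).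
Qed.

(** Near c the [m] steps of f make up at least two steps of [g], of which the leftmost takes [l], so
    l < m. If the gap extends beyond [dom g], the value g(x) = f^l(x) comes before the first passage
    time [m]. *)
Lemma escape_left f g l r m l' u p x :
  is_lorenz f -> expandingI f -> return_map f l r g ->
  lo g <= u -> u < disc g -> (1 < l')%N ->
  (forall x, u <= x < disc g -> iter_def g l' x /\ iter m f x = iter l' g x) ->
  (forall x, u <= x < disc g -> iter_def f m x) ->
  hit f `]p, disc f[%classic m -> p < lo g -> lo g <= x < disc g -> g x != disc g.
Proof.
move=> hf ef hR au uc l1 hu hu2 hm pg hx.
have hg := return_lorenz hR; have ec := return_disc hR; have hc := lorenz_lt hg.
have [b1 b2 b3 b4] := return_bounds hR.
pose T := time l r g l' u.
have Tm : T = m.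
  apply: (coincide hf ef (x := u) (y := disc g)); try lra.
  move=> z hz; have [|k1 k2] := hu z; first lra.
  have dz : dom g z by apply/domP; lra.
  have <- : time l r g l' z = T.
    apply/esym/(time_const hR) => //; try lra.
    by move=> w hw; case: (hu w) => //; lra.
  have [t1 t2] := time_iter hR dz k1; split => //; last by rewrite k2 t2.
  by apply: hu2; lra.
have lT : (l < T)%N.
  rewrite /T; case: (l') l1 => [//|[//|n]] _ /=; rewrite uc.
  rewrite -[X in (X < _)%N]addn0 ltn_add2l.
  by apply: leq_trans (time_ge hR n.+1 (g u)).
have hxc : lo g <= x < disc f by rewrite -ec.
have [_ ->] := return_left hR hxc; rewrite ec.
by apply: hm.1; [rewrite /= in_itv /=; lra|rewrite -Tm].
Qed.

Lemma escape_right f g l r m r' v q x :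
  is_lorenz f -> expandingI f -> return_map f l r g ->
  v <= hi g -> disc g < v -> (1 < r')%N ->
  (forall x, disc g < x <= v -> iter_def g r' x /\ iter m f x = iter r' g x) ->
  (forall x, disc g < x <= v -> iter_def f m x) ->
  hit f `]disc f, q[%classic m -> hi g < q -> disc g < x <= hi g -> g x != disc g.
Proof.
move=> hf ef hR vb cv r1 hv hv2 hm gq hx.
have := @escape_left (flip f) (flip g) r l m r' (- v) (- q) (- x) (lorenz_flip hf)
  (expandingI_flip ef) (return_map_flip hR).
rewrite /= opprK eqr_opp; apply => //.
- by rewrite lerN2.
- by rewrite ltrN2.
- move=> y hy; have [|k1 k2] := hv (- y); first lra.
  by rewrite !iter_flip k2; split => //; apply/iter_def_flip.
- by move=> y hy; apply/iter_def_flip/hv2; lra.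
- by rewrite -mirror_itv -hit_flip.
- by rewrite ltrN2.
- lra.
Qed.

(** If [E] missed [dom g], that interval would lie inside the gap; by the escape lemmas [g] would
    then send no point to c, contradicting the expansion of [g]. *)
Lemma assoc_meets f g h l r l' r' E p q m m' :
  is_lorenz f -> expandingI f -> return_map f l r g ->
  renorm g l' r' h -> assoc f E h p q m m' -> exists2 x, E x & dom g x.
Proof.
move=> hf ef hR hr ha; apply: contrapT => no.
have {}no x : E x -> ~ dom g x by move=> Ex dx; apply: no; exists x.
have hg := return_lorenz hR; have eg := return_expanding ef hR.
have ec := return_disc hR; have hc := lorenz_lt hg.
have [[l1 r1] _ _ _ _] := hr.
have [Ep pc _] := assoc_left ha; have [Eq cq _] := assoc_right ha.
have hR2 := assoc_return ha; have hR' := renorm_return_map hr.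
have [b1 b2 b3 b4] := return_bounds hR'.
have pg : p < lo g.
  by rewrite ltNge; apply/negP => h0; apply: (no _ Ep); apply/domP; lra.
have qg : hi g < q.
  by rewrite ltNge; apply/negP => h0; apply: (no _ Eq); apply/domP; lra.
have esc x : dom g x -> x != disc g -> g x != disc g.
  move=> /domP dx; rewrite neq_lt => /orP[xc|cx].
    apply: (escape_left hf ef hR b1 b2 l1 _ _ (assoc_hit_left ha) pg); last lra.
      move=> y hy; have [k1 k2] := return_left hR' hy.
      by rewrite ec in hy; have [_ <-] := return_left hR2 hy.
    by move=> y; rewrite ec => hy; have [] := return_left hR2 hy.
  apply: (escape_right hf ef hR b4 b3 r1 _ _ (assoc_hit_right ha) qg); last lra.
    move=> y hy; have [k1 k2] := return_right hR' hy.
    by rewrite ec in hy; have [_ <-] := return_right hR2 hy.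
  by move=> y; rewrite ec => hy; have [] := return_right hR2 hy.
apply: (@never_hits _ _ eg (lo g) (disc g)); try lra.
move=> z n hz; have dz : dom g z by apply/domP; lra.
have : z != disc g by rewrite lt_eqF //; lra.
elim: n z dz {hz} => [//|n IH] z dz zc; apply/iter_defS; split => //.
by apply: IH; [exact: lorenz_dom|exact: esc].
Qed.

End Minimal.

(** * Isolated points, derived sets and Cantor sets *)

Lemma limit_point_sub {R : realType} (A : set R) : closed A -> limit_point A `<=` A.
Proof.
by move=> cA t ht; apply: cA => U /ht[y [_ Ay Uy]]; exists y.
Qed.

Section AssocTopology.
Context {R : realType}.
Context (f h : pmap R) (E : set R) (p q : R) (l r : nat).
Context (hf : is_lorenz f) (ef : expandingI f) (ha : assoc f E h p q l r).
Implicit Types (A U : set R) (x y z : R) (n k : nat).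
Local Notation c := (disc f).

Let hE : qinv f E := assoc_qinv ha.

Lemma assoc_closed : closed E.
Proof. by case: hE. Qed.

Lemma assoc_neq x : E x -> x != c.
Proof. by case: hE => _ _ nc _ _ Ex; apply/eqP => e; rewrite e in Ex. Qed.

Lemma assoc_iter n x : E x -> E (iter n f x).
Proof. exact: qinv_iter. Qed.

Lemma assoc_iter_def n x : E x -> iter_def f n x.
Proof. by move=> Ex; exact: (qinv_iter_def hE Ex). Qed.

Lemma assoc_back n x : dom f x -> iter_def f n x -> E (iter n f x) -> E x.
Proof. exact: (cinv_iter_back hf (assoc_cinv ha)). Qed.

(* A gap of E adjacent to z is carried onto ]p, q[ by its first passage over c. *)
Lemma isolated_right_end z : E z -> ~ limit_point E z -> exists n, iter n f z = q.
Proof.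
move=> Ez nlim; have [U [hU nU]] : exists U, nbhs z U /\ forall y, y != z -> E y -> ~ U y.
  apply: contrapT => no; apply: nlim => U hU; apply: contrapT => no2; apply: no.
  by exists U; split => // y yz Ey Uy; apply: no2; exists y.
have hz := assoc_inside ha Ez; have [Eq cq minq] := assoc_right ha.
have [x1 [x2 [h1 h2 h3 h4 h5]]] := nbhs_sub_itv hU hz.
have zb : z <= hi f by lra.
have [n [hn [w /= + ew]]] := hit_ex ef (ltW h1) h2 zb (U := `]x1, z[%classic) (fun _ h => h).
rewrite in_itv /= => hw; exists n.
have def y : w <= y <= z -> iter_def f n y.
  move=> /andP[wy]; rewrite le_eqVlt => /orP[/eqP->|yz]; first exact: assoc_iter_def.
  by apply: hn; rewrite /= in_itv /=; lra.
have aw : lo f <= w by lra.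
have cz : c < iter n f z.
  by rewrite -[X in X < _]ew; apply: (iter_mono hf) => //; lra.
have qz := minq _ (assoc_iter n Ez) cz.
apply/eqP; rewrite eq_le qz andbT leNgt; apply/negP => lt.
have [||||y hy ey] := @iter_ivt _ _ hf n w z q aw; try lra.
  exact: def.
have yz : y != z by apply/eqP => e; move: lt; rewrite -e ey ltxx.
apply: (nU y yz); last by apply: h5; lra.
by apply: (@assoc_back n) => //; [apply/domP; lra|exact: def|rewrite ey].
Qed.

Lemma isolated_left_end z : E z -> ~ limit_point E z -> exists n, iter n f z = p.
Proof.
move=> Ez nlim; have [U [hU nU]] : exists U, nbhs z U /\ forall y, y != z -> E y -> ~ U y.
  apply: contrapT => no; apply: nlim => U hU; apply: contrapT => no2; apply: no.
  by exists U; split => // y yz Ey Uy; apply: no2; exists y.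
have hz := assoc_inside ha Ez; have [Ep pc maxp] := assoc_left ha.
have [x1 [x2 [h1 h2 h3 h4 h5]]] := nbhs_sub_itv hU hz.
have az : lo f <= z by lra.
have [n [hn [w /= + ew]]] := hit_ex ef az h3 (ltW h4) (U := `]z, x2[%classic) (fun _ h => h).
rewrite in_itv /= => hw; exists n.
have def y : z <= y <= w -> iter_def f n y.
  move=> /andP[]; rewrite le_eqVlt => /orP[/eqP<- _|zy yw]; first exact: assoc_iter_def.
  by apply: hn; rewrite /= in_itv /=; lra.
have wb : w <= hi f by lra.
have zc : iter n f z < c.
  by rewrite -[X in _ < X]ew; apply: (iter_mono hf) => //; lra.
have pz := maxp _ (assoc_iter n Ez) zc.
apply/eqP; rewrite eq_le pz /= leNgt; apply/negP => lt.
have [||||y hy ey] := @iter_ivt _ _ hf n z w p az; try lra.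
  exact: def.
have yz : y != z by apply/eqP => e; move: lt; rewrite -e ey ltxx.
apply: (nU y yz); last by apply: h5; lra.
by apply: (@assoc_back n) => //; [apply/domP; lra|exact: def|rewrite ey].
Qed.

Lemma assoc_fix_left : iter l f p = p.
Proof.
have [b1 b2 b3 b4] := assoc_bounds ha.
exact: (renewal_fix hf hE (assoc_left ha) b1 (assoc_hit_left ha)).
Qed.

Lemma assoc_fix_right : iter r f q = q.
Proof.
have [b1 b2 b3 b4] := assoc_bounds ha.
exact: (renewal_fix_right hf hE (assoc_right ha) b4 (assoc_hit_right ha)).
Qed.

Lemma isolated_periodic z : E z -> ~ limit_point E z -> same_periodic_orbit f p q.
Proof.
move=> Ez nlim; have [n en] := isolated_left_end Ez nlim.
have [n' en'] := isolated_right_end Ez nlim.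
have [Ep _ _] := assoc_left ha; have [[l0 r0] _ _ _ _] := assoc_return ha.
split; first by exists l; split => //; [exact: assoc_iter_def|exact: assoc_fix_left].
suff [k hk] : exists k, iter k f p = q by exists k; split => //; exact: assoc_iter_def.
have fixq N : iter (N * r) f q = q.
  by elim: N => [//|N IH]; rewrite mulSn addnC iterD assoc_fix_right.
(* [z] may reach [q] before [p]; [n] extra turns of length [r] around the periodic orbit of [q] make
   the difference of times a valid exponent. *)
exists (n' + n * r - n)%N; rewrite -en -iterD subnK; last first.
  by rewrite (leq_trans (leq_pmulr n r0)) // leq_addl.
by rewrite addnC iterD en' fixq.
Qed.

(** Points of [E] accumulating at [p] come from the left. An iterate taking [p] to [q] is increasing
    near [p], so it would send them just to the left of [q], into the gap. *)
Lemma periodic_not_limit : same_periodic_orbit f p q -> ~ limit_point E p.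
Proof.
move=> [_ [k [hk ek]]] lim; have [Ep pc maxp] := assoc_left ha.
have [Eq cq _] := assoc_right ha; have hp := assoc_inside ha Ep.
have dp : dom f p by apply/domP; lra.
have [/cvg_withinP h1 h2] := near_iter hf dp hk.
rewrite ek in h1; have h3 := h1 _ (lt_nbhsr cq).
have [x1 [x2 [k1 k2 k3 k4 k5]]] := nbhs_sub_itv (filterI h2 h3) (a := lo f) (b := c) ltac:(lra).
have hU : nbhs p `]x1, x2[%classic by apply: near_in_itvoo; rewrite in_itv /= k2.
have [y [yp Ey]] := lim _ hU; rewrite /= in_itv /= => hy.
have yp' : y < p by rewrite lt_neqAle yp maxp //; lra.
have hc := lorenz_lt hf.
have kk z : x1 <= z <= x2 -> iter_def f k z /\ c < iter k f z.
  move=> hz; have dz : dom f z by apply/domP; lra.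
  by have [u v] := k5 z hz; split; [exact: u|exact: v].
have lt : iter k f y < q.
  rewrite -ek; apply: (iter_mono hf) => //; try lra.
  by move=> z hz; have [] := kk z ltac:(lra).
have [_ gt] := kk y ltac:(lra).
by apply: (assoc_gap ha (assoc_iter k Ey)); lra.
Qed.

(** Off c and the endpoints f is locally injective and open, so it carries accumulation both ways.
    This makes minimality applicable to the derived set. *)
Lemma limit_point_qinv : qinv f (limit_point E).
Proof.
have cE := assoc_closed; have LE := limit_point_sub cE; have hc := lorenz_lt hf.
split.
- by apply: limit_point_closed; exact: hausdorff_accessible.
- by case: hE => _ dE _ _ _ x /LE/dE.
- by case: hE => _ _ nc _ _ /LE.
- move=> t Lt U hU; have Et := LE _ Lt; have ht := assoc_inside ha Et.
  have tc := assoc_neq Et.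
  have dt : dom f t by apply/domP; lra.
  have /cvg_withinP/(_ _ hU) h1 := cvg_lorenz hf dt tc.
  have [x1 [x2 [h2 hU' h3]]] : exists x1 x2, [/\ lo f <= x1 /\ x2 <= hi f,
      nbhs t `]x1, x2[%classic & (x2 <= c) || (c <= x1)].
    move: tc; rewrite neq_lt => /orP[tc|ct].
      exists (lo f), c; split; [lra| |by rewrite lexx].
      by apply: near_in_itvoo; rewrite in_itv /=; lra.
    exists c, (hi f); split; [lra| |by rewrite lexx orbT].
    by apply: near_in_itvoo; rewrite in_itv /=; lra.
  have [y [yt Ey [Uy]]] := Lt _ (filterI h1 hU').
  have tt : `]x1, x2[%classic t by exact: nbhs_singleton hU'.
  move: tt; rewrite /= !in_itv /= => tt hy.
  exists (f y); split; [|by case: hE => _ _ _ fE _; exact: fE|by apply: Uy; apply/domP; lra].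
  move: yt; rewrite !neq_lt => /orP[lt|lt]; apply/orP; [left|right].
    by case/orP: h3 => h4; [apply: (incL hf)|apply: (incR hf)] => //; lra.
  by case/orP: h3 => h4; [apply: (incL hf)|apply: (incR hf)] => //; lra.
- move=> t ht tc Lft U hU.
  have [y [yt Ey [w [dw wc Uw ew]]]] := Lft _ (nbhs_branch hf ht tc hU).
  exists w; split => //; first by apply: contra_neq yt => <-.
  by apply: (assoc_cinv ha).2 => //; rewrite ew.
Qed.

(** A component with two points would contain an interval that never meets c. *)
Lemma assoc_totally_disconnected : totally_disconnected E.
Proof.
move=> x Ex; apply/seteqP; split; last by move=> _ ->; exact: connected_component_refl.
move=> y hy /=; apply: contrapT => /eqP yx.
have /connected_intervalP itv := @component_connected _ E x.
have hx : connected_component E x x by exact: connected_component_refl.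
have sub : connected_component E x `<=` E by exact: connected_component_sub.
suff H s t : connected_component E x s -> connected_component E x t -> s < t -> False.
  by move: yx; rewrite neq_lt => /orP[]; exact: H.
move=> hs ht st; have := assoc_inside ha (sub _ hs); have := assoc_inside ha (sub _ ht).
move=> it is_; apply: (@never_hits _ _ ef s t); try lra.
move=> z n hz; apply: assoc_iter_def; apply: sub; apply: (itv s t) => //; lra.
Qed.

Lemma assoc_cantor : ~ same_periodic_orbit f p q -> cantor_set E.
Proof.
move=> np; split.
- by case: (assoc_left ha) => Ep _ _; exists p.
- apply: (subclosed_compact assoc_closed (@segment_compact _ (lo f) (hi f))).
  by case: hE.
- split; first exact: assoc_closed.
  apply/seteqP; split; first exact: limit_point_sub assoc_closed.
  by move=> z Ez; apply: contrapT => /(isolated_periodic Ez).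
- exact: assoc_totally_disconnected.
Qed.

End AssocTopology.

Lemma le_ext_trans (i j : nat) m : (i <= j)%N -> le_ext j m -> le_ext i m.
Proof. by case: m => [k|//] /=; exact: leq_trans. Qed.

(** * The tower of renormalizations *)

Section Tower.
Context {R : realType}.
Context (f : pmap R) (m : option nat) (Rf : nat -> pmap R) (K : nat -> set R).
Context (hf : is_lorenz f) (ef : expandingI f) (tower : renorm_tower f m Rf)
  (hK : forall i, (0 < i)%N -> le_ext i m -> associated f (K i) (Rf i)).
Implicit Types (A U : set R) (x y z : R) (i j n k l r : nat).
Local Notation c := (disc f).

Lemma tower0 : Rf 0%N = f.
Proof. by case: tower. Qed.

Lemma tower_renorm i : le_ext i.+1 m -> exists l r, renorm (Rf i) l r (Rf i.+1) /\
  forall l' r' G, renorm (Rf i) l' r' G -> (l <= l')%N /\ (r <= r')%N.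
Proof. by case: tower => _ h _; exact: h. Qed.

Lemma tower_dom_step i : le_ext i.+1 m -> dom (Rf i.+1) `<=` dom (Rf i).
Proof.
move=> /tower_renorm[l [r [hr _]]]; exact: return_dom (renorm_return_map hr).
Qed.

Lemma tower_dom_le i j : (i <= j)%N -> le_ext j m -> dom (Rf j) `<=` dom (Rf i).
Proof.
elim: j => [|j IH]; first by rewrite leqn0 => /eqP -> _ x.
rewrite leq_eqVlt => /orP[/eqP -> _ x//|ij hj].
by apply: subset_trans (tower_dom_step hj) _; apply: IH => //; exact: le_ext_trans hj.
Qed.

Lemma tower_dom i : le_ext i m -> dom (Rf i) `<=` dom f.
Proof. by move=> hm; rewrite -tower0; exact: tower_dom_le. Qed.

Lemma tower_lorenz i : le_ext i m -> is_lorenz (Rf i).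
Proof.
case: i => [|i]; first by rewrite tower0.
by move=> /tower_renorm[l [r [hr _]]]; case: hr.
Qed.

Lemma tower_assoc i : le_ext i.+1 m ->
  exists p q l r, assoc f (K i.+1) (Rf i.+1) p q l r.
Proof.
move=> hm; apply: associatedP => //; [exact: tower_lorenz|exact: tower_dom|exact: hK].
Qed.

Lemma tower_return i : le_ext i m -> exists l r, return_map f l r (Rf i).
Proof.
case: i => [|i]; first by rewrite tower0; exists 1%N, 1%N; exact: return_map_id.
by move=> /tower_assoc[p [q [l [r ha]]]]; exists l, r; exact: assoc_return ha.
Qed.

Lemma tower_proper i : le_ext i.+1 m -> K i.+1 `<` dom f.
Proof. by move=> /(hK (ltn0Sn i))[]. Qed.

Lemma tower_meets i : le_ext i.+1 m -> exists2 x, K i.+1 x & dom (Rf i) x.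
Proof.
move=> hm; have [l [r hR]] := tower_return (le_ext_trans (leqnSn i) hm).
have [l' [r' [hr _]]] := tower_renorm hm.
have [p [q [n [n' ha]]]] := tower_assoc hm.
exact: assoc_meets hf ef hR hr ha.
Qed.

Lemma tower_minimal i A x : le_ext i.+1 m -> qinv f A -> A `<=` K i.+1 ->
  A x -> dom (Rf i) x -> A = K i.+1.
Proof.
move=> hm; have [l [r hR]] := tower_return (le_ext_trans (leqnSn i) hm).
have [l' [r' [hr min]]] := tower_renorm hm.
have [p [q [n [n' ha]]]] := tower_assoc hm.
exact: minimal_inside hf ef hR hr min ha.
Qed.

Lemma tower_notin_orb i x : le_ext i.+1 m -> K i.+1 x -> ~ orb f (dom (Rf i.+1)) x.
Proof.
move=> /tower_assoc[p [q [l [r ha]]]] Kx /orbP[n [y dy hy]].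
exact: (assoc_disjoint hf ha (assoc_backward ha Kx hy)) dy.
Qed.

Lemma tower_alpha_meets i x : le_ext i m -> orb f (dom (Rf i)) x ->
  exists2 z, alpha f x z & dom (Rf i) z.
Proof.
move=> hm /orbP[n [y dy hy]]; have [l [r hR]] := tower_return hm.
have [z hz] := alpha_ex (tower_lorenz hm) (return_expanding ef hR) dy.
by exists z; [exact: (return_alpha hf hR hy)|exact: (alpha_dom dy)].
Qed.

Lemma tower_alpha i x : le_ext i.+1 m -> dom f x -> orb f (dom (Rf i)) x ->
  ~ orb f (dom (Rf i.+1)) x -> alpha f x = K i.+1.
Proof.
move=> hm dx ox nox; have [p [q [l [r ha]]]] := tower_assoc hm.
have sub := alpha_outside_orb hf ef ha dx nox.
have [z hz dz] := tower_alpha_meets (le_ext_trans (leqnSn i) hm) ox.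
apply: (tower_minimal hm) hz dz => //.
apply: alpha_qinv => // /sub; by case: (assoc_qinv ha) => _ _ nc.
Qed.

Lemma tower_gap i p q l r x : le_ext i.+2 m ->
  assoc f (K i.+1) (Rf i.+1) p q l r -> dom (Rf i.+1) x -> p < x < q.
Proof.
move=> hm ha /domP dx; have hR := assoc_return ha.
have [b1 b2 b3 b4] := return_bounds hR.
have [Ep pc _] := assoc_left ha; have [Eq cq _] := assoc_right ha.
apply/andP; split; rewrite ltNge; apply/negP => le.
  by apply: (assoc_disjoint hf ha Ep); apply/domP; lra.
by apply: (assoc_disjoint hf ha Eq); apply/domP; lra.
Qed.

(** The set has points of the previous interval on both sides of c, and [p] and [q] are at least as
    close to c as these. *)
Lemma tower_gap_inside i p q l r : le_ext i.+2 m ->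
  assoc f (K i.+2) (Rf i.+2) p q l r -> dom (Rf i.+1) p /\ dom (Rf i.+1) q.
Proof.
move=> hm ha; have hi1 := le_ext_trans (leqnSn _) hm.
have [l' [r' hR]] := tower_return hi1.
have [b1 b2 b3 b4] := return_bounds hR.
have [x Kx dx] := tower_meets hm.
have hg := tower_lorenz hi1; have eg := return_expanding ef hR.
have hB := return_qinv hf hR (assoc_qinv ha).
have hx : lo (Rf i.+1) < x < hi (Rf i.+1).
  move: (dx) => /domP/andP[u v]; rewrite !lt_neqAle u v !andbT.
  apply/andP; split; apply/eqP => e.
    by apply: (assoc_notin_lo hf ha hR); rewrite e.
  by apply: (assoc_notin_hi hf ha hR); rewrite -e.
have [p' [q' [_ [_ [[[Ep' _] pc' _] [[Eq' _] cq' _] hp hq _]]]]] :=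
  qinv_gaps hg eg hB (conj Kx dx) hx.
rewrite (return_disc hR) in pc' cq' hp hq.
have [Ep pc maxp] := assoc_left ha; have [Eq cq minq] := assoc_right ha.
have := maxp _ Ep' pc'; have := minq _ Eq' cq' => h1 h2.
by split; apply/domP; lra.
Qed.

(** The gaps are nested: a point of the first set outside the second would enter the smaller gap. An
    endpoint of the smaller gap lies in the larger one, which makes the inclusion strict. *)
Lemma tower_strict i : le_ext i.+2 m -> K i.+1 `<` K i.+2.
Proof.
move=> hm; have hi1 := le_ext_trans (leqnSn _) hm.
have [p [q [l [r ha]]]] := tower_assoc hi1.
have [p' [q' [l' [r' ha']]]] := tower_assoc hm.
have [dp dq] := tower_gap_inside hm ha'.
have /andP[pp pq] := tower_gap hm ha dp; have /andP[qp qq] := tower_gap hm ha dq.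
split => [z Kz|sub]; last first.
  by have [Ep' _ _] := assoc_left ha'; exact: (assoc_disjoint hf ha (sub _ Ep')) dp.
apply: contrapT => nKz; have /andP[/ltW az /ltW zb] := assoc_inside ha Kz.
have dz : dom f z by apply/domP; rewrite az.
have [k _ hk] := cinv_enter hf ef (assoc_cinv ha') (assoc_left ha') (assoc_right ha') dz nKz.
by apply: (assoc_gap ha (qinv_iter k (assoc_qinv ha) Kz)); lra.
Qed.

Lemma tower_lt i j : (i < j)%N -> le_ext j.+1 m -> K i.+1 `<` K j.+1.
Proof.
elim: j => [//|j IH]; rewrite ltnS leq_eqVlt => /orP[/eqP ->|ij] hj.
  exact: tower_strict.
have [s1 s2] := tower_strict hj.
have [t1 t2] := IH ij (le_ext_trans (leqnSn _) hj).
by split; [exact: subset_trans s1|move=> h; apply: t2; exact: subset_trans h].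
Qed.

(** One step of R^(i+1) f takes at least two steps of R^i f, so the first of these does not land on
    c, and each level delays the arrival at c by at least one step of f. *)
Lemma tower_iter_def i x : (forall j, le_ext j m) -> dom (Rf i) x -> x != c -> iter_def f i.+1 x.
Proof.
move=> le; elim: i x => [|i IH] x dx xc; first by apply/iter_defS.
have hm := le i.+1; have hi0 := le i.
have [l [r hR]] := tower_return hi0.
have [l' [r' [hr _]]] := tower_renorm hm; have hR' := renorm_return_map hr.
have xc' : x != disc (Rf i) by rewrite (return_disc hR).
have [l1 r1] : (1 < l')%N /\ (1 < r')%N by case: hr.
have [k1 _] := return_time1 hR' dx xc'.
have /iter_def_le/(_ k1)/iter_defS[_ /iter_defS[gc _]] :
    (2 <= if (x < disc (Rf i.+1))%R then l' else r')%N by case: ifP.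
have dx0 := tower_dom_step hm dx.
have dg := lorenz_dom (tower_lorenz hi0) dx0 xc'.
rewrite (return_disc hR) in gc; have := IH _ dg gc.
have [t1 ->] := return_time1 hR dx0 xc => t2.
have : iter_def f ((if (x < disc (Rf i))%R then l else r) + i.+1) x by apply/iter_defD.
apply: iter_def_le; rewrite -add1n leq_add2r.
by have [[l0 r0] _ _ _ _] := hR; case: ifP.
Qed.

(** An interval on one side of c contained in the intervals of all levels would never meet c, by
    [tower_iter_def]. *)
Lemma tower_shrink U : (forall j, le_ext j m) -> nbhs c U -> exists i, dom (Rf i) `<=` U.
Proof.
move=> le hU; have hc := lorenz_lt hf.
have [x1 [x2 [h1 h2 h3 h4 h5]]] := nbhs_sub_itv hU hc.
have b i : lo (Rf i) < c < hi (Rf i).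
  have [l [r hR]] := tower_return (le i).
  by have [b1 b2 b3 b4] := return_bounds hR; rewrite b2.
have [i hm] : exists i, x1 < lo (Rf i).
  apply: contrapT => no; apply: (@never_hits _ _ ef x1 c); try lra.
  move=> z n hz; apply: (@iter_def_le _ f n n.+1) => //; apply: tower_iter_def => //.
    apply/domP; have := b n; case: (leP (lo (Rf n)) x1) => h; first by lra.
    by case: no; exists n.
  by rewrite lt_eqF //; lra.
have [j hj] : exists j, hi (Rf j) < x2.
  apply: contrapT => no; apply: (@never_hits _ _ ef c x2); try lra.
  move=> z n hz; apply: (@iter_def_le _ f n n.+1) => //; apply: tower_iter_def => //.
    apply/domP; have := b n; case: (leP x2 (hi (Rf n))) => h; first by lra.
    by case: no; exists n.
  by rewrite gt_eqF //; lra.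
exists (i + j)%N => x dx; apply: h5.
have /domP := tower_dom_le (leq_addr j i) (le _) dx.
have /domP := tower_dom_le (leq_addl i j) (le _) dx.
by lra.
Qed.

Lemma tower_alpha_full x : dom f x -> (forall i, le_ext i m -> orb f (dom (Rf i)) x) ->
  alpha f x = dom f.
Proof.
move=> dx ox; apply: alpha_disc => //.
case em : m => [k|]; last first.
  have le i : le_ext i m by rewrite em.
  apply: closed_alpha => U /(tower_shrink le)[i sub].
  have [z hz dz] := tower_alpha_meets (le i) (ox i (le i)).
  by exists z; split => //; exact: sub.
have hk : le_ext k m by rewrite em /=.
have [l [r hR]] := tower_return hk.
have hg := tower_lorenz hk; have eg := return_expanding ef hR.
have /orbP[n [y dy hy]] := ox k hk.
have sub := return_alpha hf hR hy.
apply: contrapT => nc; have nc' : ~ alpha (Rf k) y (disc (Rf k)).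
  by rewrite (return_disc hR) => /sub.
have qA := alpha_qinv hg dy nc'.
have [z Az hz] := alpha_inside hg eg dy nc'.
have [p [q [l1 [r1 [gp gq hp hq [hl1 hr1]]]]]] := qinv_gaps hg eg qA Az hz.
have [[ap _] [_ qb]] := (andP hp, andP hq).
have [G hG] := gaps_renorm hg eg qA gp gq ap qb hl1 hr1.
by case: tower => _ _ /(_ k em); apply; exists l1, r1, G.
Qed.

(** The sets E_i; index 0 is treated apart because [K 0] is arbitrary. *)
Definition tower_set i : set R := if i is j.+1 then K j.+1 else set0.

(** The derived set misses [p], so by minimality it misses the interval of R^i f, which its points
    outside E_i would have to enter. Conversely, a point of E_i isolated in E_(i+1) would have an
    orbit through [p], which lies in that interval, disjoint from E_i. *)
Lemma tower_limit i : le_ext i.+1 m -> periodic f (K i.+1) ->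
  limit_point (K i.+1) = tower_set i.
Proof.
move=> hm per; have hi0 := le_ext_trans (leqnSn i) hm.
have [p [q [l [r ha]]]] := tower_assoc hm.
have nlim : ~ limit_point (K i.+1) p.
  apply: (periodic_not_limit hf ha); move: per.
  by rewrite /periodic (e_minusE (assoc_left ha)) (e_plusE (assoc_right ha)).
have qL := limit_point_qinv hf ha.
have LK := limit_point_sub (assoc_closed ha).
have noL x : limit_point (K i.+1) x -> ~ dom (Rf i) x.
  move=> Lx dx; apply: nlim; rewrite (tower_minimal hm qL LK Lx dx).
  by case: (assoc_left ha).
apply/seteqP; split => t.
  move=> Lt; have dt : dom f t by case: qL => _ d _ _ _; exact: d.
  case: i hm per hi0 ha nlim qL LK noL Lt => [|i] hm per hi0 ha nlim qL LK noL Lt /=.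
    by apply: (noL _ Lt); rewrite tower0.
  apply: contrapT => nKt; have [p' [q' [l' [r' ha']]]] := tower_assoc hi0.
  have [k hk kt] := assoc_enter hf ef ha' dt nKt.
  by apply: (noL _ (qinv_iter k qL Lt)); apply/domP; lra.
case: i hm per hi0 ha nlim qL LK noL => [//|i] hm per hi0 ha nlim qL LK noL /= Kt.
apply: contrapT => nLt; have [s1 _] := tower_strict hm.
have [n en] := isolated_left_end hf ef ha (s1 _ Kt) nLt.
have [p' [q' [l' [r' ha']]]] := tower_assoc hi0.
have [dp _] := tower_gap_inside hm ha.
by apply: (assoc_disjoint hf ha' (qinv_iter n (assoc_qinv ha') Kt)); rewrite en.
Qed.

Lemma orb_dom x : dom f x -> orb f (dom f) x.
Proof. by move=> dx; apply/orbP; exists 0%N, x. Qed.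

Lemma tower_alpha_cases x : dom f x ->
  (forall i, le_ext i m -> orb f (dom (Rf i)) x) \/
  exists i, [/\ le_ext i.+1 m, orb f (dom (Rf i)) x & ~ orb f (dom (Rf i.+1)) x].
Proof.
move=> dx; case: (pselect (forall i, le_ext i m -> orb f (dom (Rf i)) x)) => [|no]; first by left.
right; apply: contrapT => no2; apply: no.
elim=> [|i IH] hm; first by rewrite tower0; exact: orb_dom.
apply: contrapT => nox; apply: no2; exists i; split => //.
by apply: IH; exact: le_ext_trans hm.
Qed.

End Tower.

Theorem theoremC (R : realType) (f : pmap R) (m : option nat)
    (Rf : nat -> pmap R) (K : nat -> set R) :
  is_lorenz f -> expanding f ->
  renorm_tower f m Rf ->
  (forall i, (0 < i)%N -> le_ext i m -> associated f (K i) (Rf i)) ->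
  exists E : nat -> set R,
    [/\ [/\ E 0%N = set0,
            forall i, le_ext i.+1 m -> E i `<` E i.+1,
            forall i, le_ext i m -> E i `<` dom f
          & [set X | (exists2 x, dom f x & X = alpha f x) /\ X <> dom f] =
            [set E i | i in [set i | (0 < i)%N /\ le_ext i m]]],
        forall i, (0 < i)%N -> le_ext i m ->
          (~ periodic f (K i) -> cantor_set (E i)) /\
          (periodic f (K i) -> limit_point (E i) = E i.-1)
      & (forall i, (0 < i)%N -> le_ext i m -> forall x, dom f x ->
          (alpha f x = E i <->
           (orb f (dom (Rf i.-1)) `\` orb f (dom (Rf i))) x)) /\
        (forall x, dom f x ->
          (alpha f x = dom f <->
           (\bigcap_(i in [set i | le_ext i m]) orb f (dom (Rf i))) x))].
Proof.
move=> hf hef tower hK; have ef := (expandingP hf).1 hef.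
have proper i : le_ext i.+1 m -> K i.+1 <> dom f.
  by move=> hm e; have [_] := tower_proper hK hm; rewrite e; apply.
have inj i j : le_ext i.+1 m -> le_ext j.+1 m -> K i.+1 = K j.+1 -> i = j.
  move=> hm hj e; case: (ltngtP i j) => // lt.
    by have [_] := tower_lt hf ef tower hK lt hj; rewrite e; case.
  by have [_] := tower_lt hf ef tower hK lt hm; rewrite e; case.
exists (tower_set K); split; first split => //.
- case=> [|i] hm; last exact: (tower_strict hf ef tower hK).
  by split => // sub; have [x Kx _] := tower_meets hf ef tower hK hm; exact: (sub _ Kx).
- case=> [|i] hm; last exact: (tower_proper hK).
  by split => // sub; exact: (sub _ (disc_dom hf)).
- apply/seteqP; split => X /=.
    move=> [[x dx ->] ne]; case: (tower_alpha_cases tower dx) => [all|[i [hm ox nox]]].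
      by case: ne; exact: (tower_alpha_full hf ef tower hK).
    by exists i.+1 => //; rewrite /= (tower_alpha hf ef tower hK hm dx ox nox).
  move=> [[|i] [// _ hm] <-] /=; split; last exact: proper.
  (* A point of E_(i+1) in the interval of R^i f has E_(i+1) as its alpha-limit set, since E_(i+1)
     avoids the orbit of the next interval. *)
  have [x Kx dx] := tower_meets hf ef tower hK hm.
  have dfx := tower_dom tower (le_ext_trans (leqnSn i) hm) dx.
  exists x => //; apply/esym/(tower_alpha hf ef tower hK hm dfx).
    by apply/orbP; exists 0%N, x.
  exact: (tower_notin_orb hf ef tower hK hm).
- move=> [//|i] _ hm; split => /=; last exact: (tower_limit hf ef tower hK).
  have [p [q [l [r ha]]]] := tower_assoc hf ef tower hK hm.
  rewrite /periodic (e_minusE (assoc_left ha)) (e_plusE (assoc_right ha)).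
  exact: (assoc_cantor hf ef ha).
- split.
    move=> [//|i] _ hm x dx /=; split => [e|[ox nox]]; last exact: (tower_alpha hf ef tower hK).
    case: (tower_alpha_cases tower dx) => [all|[j [hj ox nox]]].
      by case: (proper i hm); rewrite -e; exact: (tower_alpha_full hf ef tower hK).
    have := tower_alpha hf ef tower hK hj dx ox nox.
    by rewrite e => /(inj _ _ hm hj) ->.
  move=> x dx; split => [e i hm|all]; last exact: (tower_alpha_full hf ef tower hK).
  case: (tower_alpha_cases tower dx) => [|[j [hj ox nox]]]; first exact.
  case: (proper j hj); rewrite -e.
  exact/esym/(tower_alpha hf ef tower hK hj dx ox nox).
Qed.
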